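(* Let $N\geq 2$, $p>1$ and let $\Omega\subset\mathbb{R}^N$ be a bounded and smooth domain. There exists $v\in W_0^{1,p}(\Omega)$ such that $v>0$ in $\Omega$ and $$\lim_{q\to 0^+}\left(\frac{1}{|\Omega|}\int_\Omega |v|^q\,dx\right)^{1/q}=1.$$ Moreover, $\mu(\Omega)\leq \|\nabla v\|_p^p$.
   Context: $|\Omega|$ denotes the $N$-dimensional Lebesgue measure of $\Omega$, and $\|\cdot\|_p$ the norm of $L^p(\Omega)$. For $q\in(0,1]$, $$\lambda_q(\Omega):=\inf\left\{\|\nabla v\|_p^p : v\in W_0^{1,p}(\Omega)\ \text{and}\ \int_\Omega |v|^q\,dx=1\right\}.$$ The function $q\in(0,1]\mapsto \lambda_q(\Omega)|\Omega|^{p/q}$ is monotone (non-increasing), and one defines $$\mu(\Omega):=\lim_{q\to0^+}\lambda_q(\Omega)|\Omega|^{p/q}=\sup_{0<s\le 1}\lambda_s(\Omega)|\Omega|^{p/s}\in(0,\infty].$$ *)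

(* Defs.v *)
From HB Require Import structures.
From mathcomp Require Import all_boot all_order all_algebra.
From mathcomp Require Import all_classical all_reals all_analysis.

Set Implicit Arguments.
Unset Strict Implicit.
Unset Printing Implicit Defensive.

Import Order.TTheory GRing.Theory Num.Theory.
Import numFieldNormedType.Exports.

Local Open Scope classical_set_scope.
Local Open Scope ring_scope.

(* R^n is 'rV[R]_n with the sigma-algebra generated by the coordinates, i.e.
   the Borel sets. *)
Section measurable_rV.
Context {R : realType} {n : nat}.

Let coord (i : 'I_n) (x : 'rV[R]_n) : R := x ord0 i.

Let rV_set0 : g_sigma_preimage coord set0.
Proof. exact: sigma_algebra0. Qed.

Let rV_setC A : g_sigma_preimage coord A -> g_sigma_preimage coord (~` A).
Proof. exact: sigma_algebraC. Qed.

Let rV_bigcup (F : (set 'rV[R]_n)^nat) :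
  (forall i, g_sigma_preimage coord (F i)) ->
  g_sigma_preimage coord (\bigcup_i (F i)).
Proof. exact: sigma_algebra_bigcup. Qed.

HB.instance Definition _ := @isMeasurable.Build default_measure_display
  'rV[R]_n (g_sigma_preimage coord) rV_set0 rV_setC rV_bigcup.

End measurable_rV.

Lemma measurable_coord (R : realType) n (i : 'I_n) :
  measurable_fun [set: 'rV[R]_n] (fun x : 'rV[R]_n => x ord0 i).
Proof.
move=> _ Y mY; rewrite setTI; apply: sub_sigma_algebra => /=.
rewrite -bigcup_seq/=; exists i => /=; first by rewrite mem_index_enum.
by exists Y => //; rewrite setTI.
Qed.

Lemma open_measurable_rV (R : realType) n (U : set 'rV[R]_n) :
  open U -> measurable U.
Proof.
move=> oU.
pose B (k : 'rV[rat]_n * nat) : set 'rV[R]_n :=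
  ball (map_mx (@ratr R) k.1) k.2.+1%:R^-1.
have -> : U = \bigcup_(k in [set k | B k `<=` U]) B k.
  apply/seteqP; split => [x Ux|x [k]]; last exact.
  have /nbhs_ballP[e /= e0 eU] : nbhs x U by exact: open_nbhs_nbhs.
  have e20 : 0 < e / 2 by rewrite divr_gt0.
  have [k _ /(_ k (leqnn k)) ke] := near_infty_natSinv_lt (PosNum e20).
  have k0 : 0 < k.+1%:R^-1 :> R by rewrite invr_gt0.
  have /choice[q qx] i : exists q : rat, ball (x ord0 i) k.+1%:R^-1 (ratr q : R).
    have /rat_in_itvoo[q] : x ord0 i - k.+1%:R^-1 < x ord0 i + k.+1%:R^-1.
      by rewrite ltrBlDr -addrA ltrDl addr_gt0.
    by exists q; rewrite ball_itv.
  exists (\row_i q i, k).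
    move=> y [/= _ qy]; apply: eU; split => // i j; rewrite (ord1 i).
    have := qy ord0 j; rewrite !mxE => /(ball_triangle (qx j)).
    apply: le_ball.
    by rewrite (splitr e) lerD// ltW.
  by split => //= i j; rewrite !mxE (ord1 i); exact/ball_sym.
rewrite bigcup_mkcond; apply: countable_bigcupT_measurable => // k.
case: ifPn => // _.
rewrite (_ : B k = \bigcap_i ((fun x : 'rV[R]_n => x ord0 i) @^-1`
    ball (ratr (k.1 ord0 i) : R) k.2.+1%:R^-1)).
  apply: fin_bigcap_measurable => // i _.
  rewrite -[X in measurable X]setTI; apply: measurable_coord => //.
  by rewrite ball_itv; exact: measurable_itv.
apply/seteqP; split => x /=.
  by move=> [_ h] i _; have := h ord0 i; rewrite mxE.
by move=> h; split => // i j; rewrite (ord1 i) mxE; exact: h.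
Qed.

Lemma measurable_fun_rVP d (T : measurableType d) (R : realType) n
    (f : T -> 'rV[R]_n) :
  measurable_fun [set: T] f <->
  forall i, measurable_fun [set: T] (fun t => f t ord0 i).
Proof.
split=> [mf i|mf].
  exact: (measurableT_comp (measurable_coord i) mf).
pose G := \big[setU/set0]_(i < n) preimage_set_system setT (fun x : 'rV[R]_n => x ord0 i) measurable.
apply: (@measurability _ _ _ _ _ _ G erefl) => _ [B + <-].
rewrite /G -bigcup_seq => -[i /= _ [Y mY <-]].
by rewrite !setTI; have := mf i measurableT Y mY; rewrite setTI.
Qed.

Section lebesgue_rV.
Context {R : realType}.

Definition cons_rV n (x : R * 'rV[R]_n) : 'rV[R]_n.+1 :=
  \row_i oapp (x.2 ord0) x.1 (unlift ord0 i).

Lemma measurable_cons_rV n :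
  measurable_fun [set: measurableTypeR R * 'rV[R]_n] (@cons_rV n).
Proof.
apply/measurable_fun_rVP => i; case: (unliftP ord0 i) => [j ->|->].
  rewrite (_ : (fun _ => _) = (fun y : 'rV_n => y ord0 j) \o snd).
    exact: (measurableT_comp (measurable_coord j) measurable_snd).
  by apply/funext => x; rewrite /= mxE liftK.
rewrite (_ : (fun _ => _) = fst); first exact: measurable_fst.
by apply/funext => x; rewrite /= mxE unlift_none.
Qed.

Definition tail_rV n (x : 'rV[R]_n.+1) : R * 'rV[R]_n :=
  (x ord0 ord0, \row_j x ord0 (lift ord0 j)).

Lemma measurable_tail_rV n :
  measurable_fun [set: 'rV[R]_n.+1]
    (@tail_rV n : _ -> measurableTypeR R * 'rV[R]_n).
Proof.
apply: measurable_fun_pair; first exact: measurable_coord.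
apply/measurable_fun_rVP => j.
rewrite (_ : (fun _ => _) = (fun x : 'rV_n.+1 => x ord0 (lift ord0 j))).
  exact: measurable_coord.
by apply/funext => x; rewrite mxE.
Qed.

Lemma cons_rVK n : cancel (@cons_rV n) (@tail_rV n).
Proof.
case=> t y; congr pair; first by rewrite mxE unlift_none.
by apply/rowP => j; rewrite !mxE liftK.
Qed.

Section lebesgue_step.
Context {n : nat} (m : {sigma_finite_measure set 'rV[R]_n -> \bar R}).

Definition lebesgue_step : set 'rV[R]_n.+1 -> \bar R :=
  pushforward (@lebesgue_measure R \x m)%E (@cons_rV n).

Let mcons : measurable_fun [set: measurableTypeR R * 'rV[R]_n] (@cons_rV n) :=
  @measurable_cons_rV n.

Let step0 : lebesgue_step set0 = 0%E.
Proof. by rewrite /lebesgue_step /pushforward preimage_set0 measure0. Qed.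

Let step_ge0 A : (0 <= lebesgue_step A)%E.
Proof. exact: measure_ge0. Qed.

Let step_sigma_additive : semi_sigma_additive lebesgue_step.
Proof. exact: measure_semi_sigma_additive. Qed.

HB.instance Definition _ := isMeasure.Build _ _ _ lebesgue_step
  step0 step_ge0 step_sigma_additive.

Let step_sigma_finite : sigma_finite setT lebesgue_step.
Proof.
have /sigma_finiteP[F [TF ndF Foo]] := sigma_finiteT (@lebesgue_measure R).
have /sigma_finiteP[G [TG ndG Goo]] := sigma_finiteT m.
exists (fun k => @tail_rV n @^-1` (F k `*` G k)).
  apply/esym; rewrite -preimage_bigcup -subTset => x _.
  have [i _ Fi] : (\bigcup_k F k) (tail_rV x).1 by rewrite -TF.
  have [j _ Gj] : (\bigcup_k G k) (tail_rV x).2 by rewrite -TG.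
  exists (maxn i j) => //; split.
    by move: Fi; exact/subsetPset/ndF/leq_maxl.
  by move: Gj; exact/subsetPset/ndG/leq_maxr.
move=> k; have [mF Fk] := Foo k; have [mG Gk] := Goo k; split.
  by rewrite -[X in measurable X]setTI; apply: measurable_tail_rV => //;
    exact: measurableX.
rewrite /lebesgue_step /pushforward -comp_preimage.
rewrite (_ : _ \o _ = id) ?preimage_id; last first.
  by apply/funext => x; exact: cons_rVK.
by rewrite product_measure1E// lte_mul_pinfty// ge0_fin_numE.
Qed.

HB.instance Definition _ :=
  Measure_isSigmaFinite.Build _ _ _ lebesgue_step step_sigma_finite.

End lebesgue_step.

(* N-dimensional Lebesgue measure, as an iterated product. *)
Fixpoint lebesgue_rV n : {sigma_finite_measure set 'rV[R]_n -> \bar R} :=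
  if n is k.+1 then lebesgue_step (lebesgue_rV k) else \d_(0 : 'rV[R]_0).

Lemma lebesgue_rV_box n (A : 'I_n -> set R) :
  (forall i, measurable (A i)) ->
  lebesgue_rV n [set x | forall i, A i (x ord0 i)] =
  (\prod_(i < n) lebesgue_measure (A i))%E.
Proof.
elim: n A => [|n IHn] A mA.
  rewrite big_ord0 /= diracE (_ : _ \in _)// inE => -[] //.
rewrite big_ord_recl -IHn//= /lebesgue_step /pushforward.
rewrite -product_measure1E//; last first.
  rewrite [X in measurable X](_ : _ = \bigcap_i ((fun x : 'rV[R]_n => x ord0 i) @^-1`
    A (lift ord0 i))).
    apply: fin_bigcap_measurable => // i _.
    by rewrite -[X in measurable X]setTI; exact: measurable_coord.
  by apply/seteqP; split => x /= h i; [move=> _; exact: h|exact: (h i I)].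
  exact: mA.
congr (product_measure1 _ _ _); apply/seteqP; split=> -[t y] /=.
  move=> Aty; split; first by have := Aty ord0; rewrite mxE unlift_none.
  by move=> i; have := Aty (lift ord0 i); rewrite mxE liftK.
case=> At Ay i; rewrite mxE; case: (unliftP ord0 i) => [j ->|->] /=.
  exact: Ay.
exact: At.
Qed.

End lebesgue_rV.

Section domain.
Context {R : realType} {N : nat}.
Implicit Types (f : 'rV[R]_N -> R) (Om : set 'rV[R]_N).

Definition partial (i : 'I_N) f : 'rV[R]_N -> R := 'D_(delta_mx ord0 i) f.

Definition gradient f (x : 'rV[R]_N) : 'rV[R]_N := \row_i partial i f x.

(* The norm of 'rV[R]_N in the library is the sup norm. *)
Definition enorm (x : 'rV[R]_N) : R := Num.sqrt (\sum_i x ord0 i ^+ 2).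

(* C^oo on R^N: all iterated partial derivatives exist and are continuous. *)
Definition smooth f := forall s : seq 'I_N,
  let h := foldr partial f s in
  continuous h /\ forall i x, derivable h x (delta_mx ord0 i).

End domain.

(* Near each boundary point, up to the choice of a coordinate x_i and of its
   orientation, Om is the region on one side of the graph of a smooth function
   of the N - 1 other coordinates. *)
Definition smooth_boundary (R : realType) N (Om : set 'rV[R]_N) :=
  forall x0, (closure Om `\` interior Om) x0 ->
  exists (i : 'I_N) (b : bool) (gam : 'rV[R]_N.-1 -> R), smooth gam /\
    \forall x \near x0, Om x <-> 0 < (-1) ^+ b * (x ord0 i - gam (col' i x)).

Definition bounded_smooth_domain (R : realType) N (Om : set 'rV[R]_N) :=
  [/\ Om !=set0, open Om, connected Om, bounded_set Om & smooth_boundary Om].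

Section sobolev.
Context {R : realType} {N : nat}.
Local Notation vol := (@lebesgue_rV R N).
Implicit Types (Om : set 'rV[R]_N) (f v : 'rV[R]_N -> R).
Implicit Types (g : 'rV[R]_N -> 'rV[R]_N) (p q : R).

(* Functions on Om are represented by functions on R^N whose values outside Om
   are irrelevant. *)
Definition int_pow Om p f : \bar R :=
  (\int[vol]_(x in Om) (`|f x| `^ p)%:E)%E.

Definition Lp Om p f := measurable_fun Om f /\ (int_pow Om p f < +oo)%E.

(* C_c^oo(Om), each function being extended by zero to R^N. *)
Definition test_function Om f :=
  let supp := closure [set x | f x != 0] in
  [/\ smooth f, compact supp & supp `<=` Om].

Definition weak_gradient Om v g := forall phi, test_function Om phi ->
  forall i : 'I_N,
    (\int[vol]_(x in Om) (v x * partial i phi x)%:E =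
     - \int[vol]_(x in Om) (g x ord0 i * phi x)%:E)%E.

(* v belongs to W^{1,p}(Om), with g (a representative of) its gradient, which
   is determined by v almost everywhere in Om. *)
Definition W1p Om p v g :=
  [/\ Lp Om p v, forall i, Lp Om p (fun x => g x ord0 i) &
      weak_gradient Om v g].

(* W_0^{1,p}(Om) is the closure of C_c^oo(Om) in W^{1,p}(Om). *)
Definition W01p Om p v g := W1p Om p v g /\
  exists phi : nat -> 'rV[R]_N -> R,
    (forall k, test_function Om (phi k)) /\
    (int_pow Om p (fun x => phi k x - v x)%R +
     int_pow Om p (fun x => enorm (gradient (phi k) x - g x))%R)%E
      @[k --> \oo] --> 0%E.

Definition dirichlet_energy Om p g : \bar R :=
  int_pow Om p (fun x => enorm (g x)).

Definition lambda Om p q : \bar R :=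
  ereal_inf [set E | exists v g, [/\ W01p Om p v g, int_pow Om q v = 1%E &
                                     E = dirichlet_energy Om p g]].

(* The function under the limit is non-increasing on ]0, 1] for bounded Om, so
   the limit exists in \bar R and is the supremum over ]0, 1]. *)
Definition mu Om p : \bar R :=
  lim ((lambda Om p q * vol Om `^ (p / q))%E @[q --> 0^'+]).

End sobolev.

(* Main.v *)
Require Import Defs.
From mathcomp Require Import all_boot all_order all_algebra.
From mathcomp Require Import all_classical all_reals all_analysis.
From mathcomp Require Import measurable_realfun ring lra zify.
Import Order.TTheory GRing.Theory Num.Theory numFieldNormedType.Exports.
Local Open Scope classical_set_scope.
Local Open Scope ring_scope.
Set Implicit Arguments.
Unset Strict Implicit.
Unset Printing Implicit Defensive.

(** Everything rests on a function u in W_0^{1,p}(Om), bounded and positive in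
Om, whose logarithm is square integrable on Om. Dividing u by its geometric
mean gives v with integral of ln v equal to 0. The inequalities
1 + t <= exp t <= 1 + t + t^2 exp b, valid for t <= b with b >= 0, applied to
t = q ln v and integrated, give |Om| <= \int v^q <= |Om| + K q^2
([int_pow_near_vol]); after division by |Om| the power 1/q of the middle term
lies between 1 and exp(K q / |Om|), so it tends to 1 ([geometric_mean_cvg]).
The lower bound |Om| <= \int v^q also says that v, rescaled to be admissible in
the infimum defining lambda_q, has energy at most |Om|^(-p/q) times the energy
of v ([lambda_vol_le]). Hence lambda_q |Om|^(p/q) is at most the energy of v for
every q in ]0, 1], and so is its limit at 0+, which exists because the quantity
is non-increasing in q ([lambda_vol_nonincreasing], a form of Jensen's
inequality).

The function u is a sum of test functions psi_k ([whitney]). For each k, psi_k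
is the sum of smooth cutoffs of radius 2/2^k around the points of the grid of
step 2^-k whose supporting cubes lie in Om, multiplied by a constant of order
2^(-k(n+2)). There are at most a constant times 2^(kn) such cutoffs, with
gradients of order 2^k, so psi_k and its first derivatives are bounded by 2^-k:
the partial sums converge uniformly with their gradients, which puts u in
W_0^{1,p}(Om) ([W01p_series]). If the cube of centre x and radius 3/2^k lies in
Om, then x is in the core of one of the cutoffs and u(x) is at least a constant
times 2^(-k(n+2)) ([whitney_lower]), so that -ln u(x) grows at most linearly
in k. The points of Om for which that cube sticks out of Om form a collar of
the boundary, of volume O(2^-k) ([collar_volume]): there the boundary is the
graph of a Lipschitz function, and this is where its regularity is used. The
series of k 2^-k converges, and (ln u)^2 is integrable
([log_square_integral]).

Lebesgue measure enters mostly through its translation invariance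
([lebesgue_rV_shift]). It gives the integration by parts needed for the weak
gradient of u, since the integral of a difference quotient vanishes, and it
bounds the collar without Fubini's theorem: translates of the collar in the
direction of the graph are disjoint and remain in a bounded cube. *)

(** * Calculus of smooth functions *)

(** A directional derivative is a one-variable derivative along the line, so the
one-variable chain rule and mean value theorem apply to it. *)
Lemma is_derive_line {R : realType} {V W : normedModType R} (f : V -> W) x v d :
  is_derive x v f d <-> is_derive (0 : R) (1 : R) (fun h : R => f (h *: v + x)) d.
Proof.
have dE : 'D_v f x = 'D_1 (fun h : R => f (h *: v + x)) 0.
  rewrite /derive; set F := fun h => h^-1 *: _; set G := fun h => h^-1 *: _.
  suff -> : F = G by []; apply/funext => h; rewrite /F /G /=.
  by rewrite addr0 scale0r add0r [_%:A]mulr1.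
split=> -[df vf]; split.
- exact: ((derivable1P _ _ _).1 df).
- by rewrite -dE.
- exact: ((derivable1P _ _ _).2 df).
- by rewrite dE.
Qed.

Section smooth_calculus.
Context {R : realType} {n : nat}.
Implicit Types (f g : 'rV[R]_n -> R) (i : 'I_n) (x v : 'rV[R]_n).
Local Notation e i := (delta_mx ord0 i : 'rV[R]_n).

(** The recursion peels off the innermost derivative. This makes the product
rule an induction on k, which is awkward on the lists of directions in the
definition of [smooth]. *)
Fixpoint Ck k f : Prop :=
  if k is k'.+1 then
    continuous f /\
    forall i, (forall x, derivable f x (e i)) /\ Ck k' (partial i f)
  else continuous f.

Lemma smooth_continuous f : smooth f -> continuous f.
Proof. by move=> /(_ [::]) []. Qed.

Lemma smooth_derivable f i x : smooth f -> derivable f x (e i).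
Proof. by move=> /(_ [::]) []. Qed.

Lemma smooth_partial f i : smooth f -> smooth (partial i f).
Proof. by move=> sf s; have := sf (rcons s i); rewrite /= foldr_rcons. Qed.

Lemma smoothP f : smooth f <-> forall k, Ck k f.
Proof.
split=> [sf k|Cf s].
  elim: k f sf => [|k IH] f sf /=; first exact: smooth_continuous.
  split; first exact: smooth_continuous.
  by move=> i; split=> [x|]; [exact: smooth_derivable|exact/IH/smooth_partial].
suff H k g : Ck k.+1 g -> (size s <= k)%N -> let h := foldr partial g s in
    continuous h /\ forall i x, derivable h x (e i).
  exact: (H (size s)).
elim/last_ind: s k g => [|s i IH] k g.
  by case=> cg dg _; split=> // i; case: (dg i).
case: k => [|k]; first by rewrite size_rcons.
case=> cg dg; rewrite size_rcons ltnS foldr_rcons => sk.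
by apply: (IH k) => //; case: (dg i).
Qed.

Lemma Ck_S k f : Ck k.+1 f -> Ck k f.
Proof.
elim: k f => [|k IH] f; first by case.
by case=> cf df; split=> // i; have [d C] := df i; split=> //; exact: IH.
Qed.

Lemma partialD i f g : (forall x, derivable f x (e i)) ->
  (forall x, derivable g x (e i)) ->
  partial i (f \+ g) = partial i f \+ partial i g.
Proof. by move=> df dg; apply/funext => x; rewrite /partial /= -deriveD. Qed.

Lemma partialM i f g : (forall x, derivable f x (e i)) ->
  (forall x, derivable g x (e i)) ->
  partial i (f \* g) = (f \* partial i g) \+ (g \* partial i f).
Proof. by move=> df dg; apply/funext => x; rewrite /partial /= deriveM. Qed.

Lemma partialZ i f (c : R) : (forall x, derivable f x (e i)) ->
  partial i (fun x => c * f x) = (fun x => c * partial i f x).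
Proof. by move=> df; apply/funext => x; rewrite /partial /= deriveZ. Qed.

Lemma continuous_addf f g : continuous f -> continuous g -> continuous (f \+ g).
Proof. by move=> cf cg x; exact: (continuousD (cf x) (cg x)). Qed.

Lemma continuous_mulf f g : continuous f -> continuous g -> continuous (f \* g).
Proof. by move=> cf cg x; exact: (continuousM (cf x) (cg x)). Qed.

Lemma partial_cst i (c : R) : partial i (fun _ : 'rV[R]_n => c) = fun=> 0.
Proof. by apply/funext => x; rewrite /partial derive_cst. Qed.

Lemma Ck_cst k (c : R) : Ck k (fun=> c).
Proof.
elim: k c => [|k IH] c; first exact: cst_continuous.
split=> [|i]; first exact: cst_continuous.
by rewrite partial_cst; split=> // x; exact: derivable_cst.
Qed.

Lemma CkD k f g : Ck k f -> Ck k g -> Ck k (f \+ g).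
Proof.
elim: k f g => [|k IH] f g; first exact: continuous_addf.
case=> cf df [cg dg]; split=> [|i]; first exact: continuous_addf.
have [dfi Cfi] := df i; have [dgi Cgi] := dg i.
by split=> [x|]; [exact: derivableD|rewrite partialD//; exact: IH].
Qed.

Lemma CkM k f g : Ck k f -> Ck k g -> Ck k (f \* g).
Proof.
elim: k f g => [|k IH] f g; first exact: continuous_mulf.
move=> /[dup] /Ck_S Cf [cf df] /[dup] /Ck_S Cg [cg dg].
split=> [|i]; first exact: continuous_mulf.
have [dfi Cfi] := df i; have [dgi Cgi] := dg i.
by split=> [x|]; [exact: derivableM|rewrite partialM//; apply: CkD; exact: IH].
Qed.

Lemma smooth_cst (c : R) : smooth (fun _ : 'rV[R]_n => c).
Proof. by apply/smoothP => k; exact: Ck_cst. Qed.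

Lemma smoothD f g : smooth f -> smooth g -> smooth (f \+ g).
Proof. by move=> /smoothP Cf /smoothP Cg; apply/smoothP => k; exact: CkD. Qed.

Lemma smoothM f g : smooth f -> smooth g -> smooth (f \* g).
Proof. by move=> /smoothP Cf /smoothP Cg; apply/smoothP => k; exact: CkM. Qed.

Lemma smooth_scale (c : R) f : smooth f -> smooth (fun x => c * f x).
Proof. by move=> sf; exact: (smoothM (smooth_cst c) sf). Qed.

Lemma smooth_sum (I : Type) (r : seq I) (P : pred I) (F : I -> 'rV[R]_n -> R) :
  (forall j, P j -> smooth (F j)) -> smooth (fun x => \sum_(j <- r | P j) F j x).
Proof.
move=> sF; rewrite (_ : (fun x => _) = \sum_(j <- r | P j) F j).
  apply: (big_ind (fun f => smooth f)) => //; first exact: (smooth_cst 0).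
  exact: smoothD.
by apply/funext => x; rewrite fct_sumE.
Qed.

Lemma smooth_prod (I : Type) (r : seq I) (P : pred I) (F : I -> 'rV[R]_n -> R) :
  (forall j, P j -> smooth (F j)) -> smooth (fun x => \prod_(j <- r | P j) F j x).
Proof.
move=> sF; elim: r => [|j r IH].
  rewrite (_ : (fun x => _) = (fun=> 1)); first exact: smooth_cst.
  by apply/funext => x; rewrite big_nil.
have [Pj|nPj] := boolP (P j); last first.
  rewrite (_ : (fun x => _) = (fun x => \prod_(j <- r | P j) F j x))//.
  by apply/funext => x; rewrite big_cons (negbTE nPj).
rewrite (_ : (fun x => _) = F j \* (fun x => \prod_(j <- r | P j) F j x)).
  by apply: smoothM => //; exact: sF.
by apply/funext => x; rewrite big_cons Pj.
Qed.

Lemma partial_sum i (I : Type) (r : seq I) (P : pred I) (F : I -> 'rV[R]_n -> R) :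
  (forall j, P j -> smooth (F j)) ->
  partial i (fun x => \sum_(j <- r | P j) F j x) =
  (fun x => \sum_(j <- r | P j) partial i (F j) x).
Proof.
move=> sF; elim: r => [|j r IH].
  under eq_fun do rewrite big_nil.
  by rewrite partial_cst; apply/funext => x; rewrite big_nil.
have [Pj|nPj] := boolP (P j); last first.
  under eq_fun do rewrite big_cons (negbTE nPj).
  by rewrite IH; apply/funext => x; rewrite big_cons (negbTE nPj).
rewrite (_ : (fun x => _) = F j \+ (fun x => \sum_(j <- r | P j) F j x)).
  rewrite partialD.
  - by rewrite IH; apply/funext => x; rewrite big_cons Pj.
  - by move=> x; apply: smooth_derivable; exact: sF.
  - by move=> x; apply: smooth_derivable; exact: smooth_sum.
by apply/funext => x; rewrite big_cons Pj.
Qed.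

End smooth_calculus.

Section coordinate_functions.
Context {R : realType} {n : nat}.
Implicit Types (i j : 'I_n) (x : 'rV[R]_n).
Local Notation e i := (delta_mx ord0 i : 'rV[R]_n).

Lemma coord_line i j x (h : R) :
  (h *: e i + x) ord0 j = (j == i)%:R * h + x ord0 j.
Proof. by rewrite !mxE eqxx /= mulrC. Qed.

Lemma is_derive_coord (F : R -> R) j i x (d : R) :
  is_derive (x ord0 j) 1 F d ->
  is_derive x (e i) (fun y => F (y ord0 j)) ((j == i)%:R * d).
Proof.
move=> dF; apply/is_derive_line.
under eq_fun do rewrite coord_line.
case: eqVneq => ji.
  rewrite mul1r; under eq_fun do rewrite mul1r.
  have -> : (fun h : R => F (h + x ord0 j)) = F \o (shift (x ord0 j)) by [].
  rewrite -[d]mulr1; apply: is_derive1_comp; first by rewrite /= add0r.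
  exact: is_derive_shift.
rewrite mul0r; under eq_fun do rewrite mul0r add0r.
exact: is_derive_cst.
Qed.

Lemma continuous_coord_fun (F : R -> R) j : continuous F ->
  continuous (fun x : 'rV[R]_n => F (x ord0 j)).
Proof.
move=> cF x; apply: (@continuous_comp _ _ _ (fun y : 'rV[R]_n => y ord0 j) F).
  exact: coord_continuous.
exact: cF.
Qed.

End coordinate_functions.

(** * Smooth cutoffs of cubes *)

Lemma is_derive_affine {R : realType} (a b t : R) :
  is_derive t 1 (fun y : R => a * y + b) a.
Proof.
apply: (is_derive_eq (is_deriveD (is_deriveZ a (is_derive_id t 1)) (is_derive_cst b t 1))).
by rewrite addr0 -[_ *: _]/(_ * _) mulr1.
Qed.

Section decay.
Context {R : realType}.
Implicit Types (t : R) (m : nat).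

(** The derivatives of exp(-1/t), extended by 0 to t <= 0, are linear
combinations of these functions. Their span is closed under differentiation
([is_derive_decay]), which gives smoothness without polynomials in 1/t. *)
Definition decay m t : R := if 0 < t then t^-1 ^+ m * expR (- t^-1) else 0.

Lemma decay_ge0 m t : 0 <= decay m t.
Proof.
rewrite /decay; case: ifP => // t0.
by rewrite mulr_ge0 ?expR_ge0 ?exprn_ge0 ?invr_ge0 ?ltW.
Qed.

(** The exponential series dominates each of its terms at 1/t. For k = 1 this is
the quadratic flatness at 0 that makes the derivative there vanish. *)
Lemma decay_le m k t : 0 < t -> decay m t <= (m + k.+1)`!%:R * t ^+ k.+1.
Proof.
move=> t0; rewrite /decay t0 expRN.
rewrite ler_pdivrMr ?expR_gt0//.
have s0 : 0 <= t^-1 by rewrite invr_ge0 ltW.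
have := @expR_ge1Dxn R t^-1 (m + k) s0; rewrite -addnS => h.
have -> : t^-1 ^+ m = t^-1 ^+ (m + k.+1) * t ^+ k.+1.
  by rewrite exprD -mulrA -exprMn mulVf ?gt_eqF// expr1n mulr1.
rewrite mulrAC ler_pM2r ?exprn_gt0// -ler_pdivrMl ?ltr0n ?fact_gt0// mulrC.
by apply: le_trans h; rewrite lerDr.
Qed.

Lemma is_derive_decay m t :
  is_derive t 1 (decay m) (decay m.+2 t - m%:R * decay m.+1 t).
Proof.
case: (ltgtP t 0) => [t0|t0|->].
- have -> : decay m.+2 t - m%:R * decay m.+1 t = 0.
    by rewrite /decay ltNge (ltW t0) /= mulr0 subr0.
  apply: near_eq_is_derive (is_derive_cst (0 : R) t 1).
  near=> y; rewrite /decay ltNge ltW//=.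
  by near: y; exact: lt_nbhsl.
- have tN0 : t != 0 by rewrite gt_eqF.
  have dV : is_derive t 1 (fun y : R => y^-1) (- t^-1 ^+ 2).
    apply: (is_derive_eq (is_deriveV tN0 (is_derive_id t 1))).
    by rewrite scaler1 exprVn.
  have dE : is_derive t 1 (fun y : R => expR (- y^-1)) (expR (- t^-1) * t^-1 ^+ 2).
    have -> : (fun y : R => expR (- y^-1)) = expR \o (fun y : R => - y^-1) by [].
    apply: is_derive1_comp.
    exact: (is_derive_eq (is_deriveN dV) (opprK _)).
  have dX : is_derive t 1 (fun y : R => y^-1 ^+ m) (- (m%:R * t^-1 ^+ m.+1)).
    have -> : (fun y : R => y^-1 ^+ m) = (fun y : R => y^-1) ^+ m.
      by apply/funext => y; rewrite fctE.
    apply: (is_derive_eq (is_deriveX m dV)).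
    rewrite -[LHS]/(_ * _) mulrN; congr (- _).
    by case: m => [|m /=]; rewrite ?mul0r// !exprS; ring.
  apply: near_eq_is_derive (is_derive_eq (is_deriveM dX dE) _).
    near=> y; rewrite /decay ifT//.
    by near: y; exact: lt_nbhsr.
  rewrite /decay t0 -![_ *: _]/(_ * _) !exprS; ring.
- have -> : decay m.+2 0 - m%:R * decay m.+1 0 = 0.
    by rewrite /decay ltxx mulr0 subr0.
  suff H : (fun h : R => h^-1 *: ((decay m \o shift 0) (h *: 1) - decay m 0)) @ 0^' --> (0 : R).
    split; first by apply/cvg_ex; exists 0.
    exact: cvg_lim.
  (* At 0 the difference quotient is at most C h, by quadratic flatness. *)
  pose C : R := (m + 2)`!%:R.
  have C0 : 0 < C by rewrite ltr0n fact_gt0.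
  apply/cvgr0Pnorm_lt => eps eps0; near=> h.
  rewrite /= addr0 [_%:A]mulr1 {2}/decay ltxx subr0.
  have h0 : h != 0 by near: h; exact: nbhs_dnbhs_neq.
  have hC : `|h| < eps / C.
    near: h; apply: dnbhs0_lt; exact: divr_gt0.
  have [hp|hn] := ltP 0 h; last first.
    by rewrite /decay [0 < h]ltNge hn /= scaler0 normr0.
  rewrite -[_ *: _]/(_ * _) normrM normfV (ger0_norm (decay_ge0 _ _)) gtr0_norm//.
  rewrite ltr_pdivrMl//; apply: le_lt_trans (decay_le m 1 hp) _.
  rewrite gtr0_norm// in hC; rewrite -/C expr2 mulrCA.
  by rewrite ltr_pM2l// mulrC -ltr_pdivlMr.
Unshelve. all: by end_near. Qed.

Lemma decay0_le1 t : decay 0 t <= 1.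
Proof.
rewrite /decay; case: ifP => // t0; rewrite expr0 mul1r -expR0 ler_expR.
by rewrite oppr_le0 invr_ge0 ltW.
Qed.

Lemma decay2_le2 t : decay 2 t <= 2.
Proof.
rewrite /decay; case: ifP => // t0; rewrite expRN ler_pdivrMr ?expR_gt0//.
have s0 : 0 <= t^-1 by rewrite invr_ge0 ltW.
have := @expR_ge1Dxn R t^-1 1 s0; rewrite -ler_pdivrMl// => h.
by apply: le_trans h; rewrite mulrC lerDr.
Qed.

Lemma decay0_ge_half t : 2^-1 <= t -> expR (- 2) <= decay 0 t.
Proof.
move=> t2; have t0 : 0 < t by apply: lt_le_trans t2; rewrite invr_gt0.
rewrite /decay t0 expr0 mul1r ler_expR lerN2.
by rewrite -[leRHS]invrK lef_pV2 ?posrE// ?invr_gt0.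
Qed.

End decay.

Section cutoff.
Context {R : realType} {n : nat}.
Implicit Types (z x : 'rV[R]_n) (i j : 'I_n) (r : R).
Local Notation e i := (delta_mx ord0 i : 'rV[R]_n).

(** The induction on the order of differentiation has to treat all the functions
of the family at once, since differentiation moves along it. *)
Lemma smooth_decay_coord m (a b : R) j :
  smooth (fun x : 'rV[R]_n => decay m (a * x ord0 j + b)).
Proof.
have dmab m' (t : R) : is_derive t 1 (fun y : R => decay m' (a * y + b))
    ((decay m'.+2 (a * t + b) - m'%:R * decay m'.+1 (a * t + b)) * a).
  by apply: (is_derive1_comp (is_derive_decay _ _) (is_derive_affine a b t)).
have dE m' i x := @is_derive_coord R n _ j i x _ (dmab m' (x ord0 j)).
apply/smoothP => k; elim: k m => [|k IH] m.
  apply: (@continuous_coord_fun R n (fun t => decay m (a * t + b))) => t.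
  by apply/differentiable_continuous/derivable1_diffP; have [] := dmab m t.
split=> [|i].
  apply: (@continuous_coord_fun R n (fun t => decay m (a * t + b))) => t.
  by apply/differentiable_continuous/derivable1_diffP; have [] := dmab m t.
split=> [x|]; first by have [] := dE m i x.
rewrite (_ : partial i _ =
    (fun x : 'rV[R]_n => decay m.+2 (a * x ord0 j + b) * ((j == i)%:R * a)) \+
    (fun x : 'rV[R]_n => decay m.+1 (a * x ord0 j + b) * (- m%:R * (j == i)%:R * a))).
  by apply: CkD; apply: (CkM (IH _)); exact: Ck_cst.
apply/funext => x; rewrite /partial (@derive_val _ _ _ _ _ _ _ (dE m i x)) /=.
ring.
Qed.

(** With s = (x_j - z_j) / r this is exp(-1/(1+s)) exp(-1/(1-s)) for |s| < 1 and
0 elsewhere. *)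
Definition cutoff1 z r j x : R :=
  decay 0 (r^-1 * x ord0 j + (1 - r^-1 * z ord0 j)) *
  decay 0 (- r^-1 * x ord0 j + (1 + r^-1 * z ord0 j)).

Definition cutoff z r x : R := \prod_j cutoff1 z r j x.

Lemma smooth_cutoff1 z r j : smooth (cutoff1 z r j).
Proof. by apply: smoothM; exact: smooth_decay_coord. Qed.

Lemma smooth_cutoff z r : smooth (cutoff z r).
Proof. by apply: smooth_prod => j _; exact: smooth_cutoff1. Qed.

Lemma cutoff1_ge0 z r j x : 0 <= cutoff1 z r j x.
Proof. by rewrite mulr_ge0// decay_ge0. Qed.

Lemma cutoff1_le1 z r j x : cutoff1 z r j x <= 1.
Proof. by rewrite mulr_ile1 ?decay_ge0 ?decay0_le1. Qed.

Lemma cutoff_ge0 z r x : 0 <= cutoff z r x.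
Proof. by apply: prodr_ge0 => j _; exact: cutoff1_ge0. Qed.

Lemma cutoff_le1 z r x : cutoff z r x <= 1.
Proof. by apply: prodr_ile1 => j _; rewrite cutoff1_ge0 cutoff1_le1. Qed.

Lemma cutoff_support z r x : 0 < r -> cutoff z r x != 0 ->
  forall j, `|x ord0 j - z ord0 j| <= r.
Proof.
move=> r0 bx j; have : cutoff1 z r j x != 0.
  by apply: contraNN bx => /eqP b0; rewrite /cutoff (bigD1 j)//= b0 mul0r.
rewrite mulf_eq0 negb_or /decay => /andP[].
case: ifPn; last by rewrite eqxx.
move=> h1 _; case: ifPn; last by rewrite eqxx.
move=> h2 _; rewrite ler_norml.
have {}h1 : 0 < 1 + r^-1 * (x ord0 j - z ord0 j) by move: h1; rewrite mulrBr; lra.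
have {}h2 : 0 < 1 - r^-1 * (x ord0 j - z ord0 j) by move: h2; rewrite mulrBr; lra.
have rE : x ord0 j - z ord0 j = r * (r^-1 * (x ord0 j - z ord0 j)) by rewrite mulVKf// gt_eqF.
move: h1 h2 rE; move: (r^-1 * _) => u h1 h2 ->; apply/andP; split; nra.
Qed.

(** Each of the 2n factors is exp(-1/s) with s >= 1/2. *)
Lemma cutoff_center z r x : 0 < r ->
  (forall j, `|x ord0 j - z ord0 j| <= r / 2) -> expR (- 4) ^+ n <= cutoff z r x.
Proof.
move=> r0 xz; rewrite -[n in leLHS]card_ord -prodr_const.
apply: ler_prod => j _; rewrite expR_ge0 /=.
have -> : - 4 = - 2 + - 2 :> R by lra.
have := xz j; rewrite ler_norml => /andP[h1 h2].
have {}h1 : - 2^-1 <= r^-1 * (x ord0 j - z ord0 j) by rewrite ler_pdivlMl//; lra.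
have {}h2 : r^-1 * (x ord0 j - z ord0 j) <= 2^-1 by rewrite ler_pdivrMl//; lra.
rewrite mulrBr in h1 h2.
by rewrite expRD ler_pM ?expR_ge0 ?decay0_ge_half//; lra.
Qed.

(** Only one of the n factors depends on x_i. Its derivative is at most 4 / r in
absolute value because exp(-1/s)/s^2 <= 2, and the others are at most 1. *)
Lemma cutoff_partial_le z r i x : 0 < r -> `|partial i (cutoff z r) x| <= 4 / r.
Proof.
move=> r0.
have d1 (a b : R) j : is_derive x (e i) (fun x : 'rV[R]_n => decay 0 (a * x ord0 j + b))
    ((j == i)%:R * (decay 2 (a * x ord0 j + b) * a)).
  have := is_derive1_comp (is_derive_decay 0 _) (is_derive_affine a b (x ord0 j)).
  by rewrite mul0r subr0; exact: (@is_derive_coord R n (fun t => decay 0 (a * t + b))).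
have db j : is_derive x (e i) (cutoff1 z r j) _ := is_deriveM (d1 _ _ j) (d1 _ _ j).
pose rest x := \prod_(j | j != i) cutoff1 z r j x.
have -> : cutoff z r = cutoff1 z r i \* rest.
  by apply/funext => y; rewrite /cutoff (bigD1 i).
have drest : is_derive x (e i) rest 0.
  apply/is_derive_line; rewrite (_ : (fun h : R => _) = cst (rest x)).
    exact: is_derive_cst.
  apply/funext => h; apply: eq_bigr => j ji.
  by rewrite /cutoff1 !coord_line (negbTE ji) mul0r add0r.
rewrite /partial (@derive_val _ _ _ _ _ _ _ (is_deriveM (db i) drest)).
rewrite eqxx !mul1r -![_ *: _]/(_ * _) mulr0 add0r.
set A := decay 0 _; set B := decay 0 _; set A' := decay 2 _; set B' := decay 2 _.
have rest1 : 0 <= rest x <= 1.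
  rewrite prodr_ge0 /=; last by move=> *; exact: cutoff1_ge0.
  by apply: prodr_ile1 => j _; rewrite cutoff1_ge0 cutoff1_le1.
rewrite normrM -[4 / r]mul1r ler_pM//.
  by rewrite ger0_norm; case/andP: rest1.
apply: le_trans (ler_normD _ _) _.
have [rV A0 A1 B0] : [/\ 0 < r^-1, 0 <= A, A <= 1 & 0 <= B].
  by rewrite invr_gt0 ?decay_ge0 ?decay0_le1.
have [B1 A0' A1'] : [/\ B <= 1, 0 <= A' & A' <= 2].
  by rewrite ?decay_ge0 ?decay0_le1 ?decay2_le2.
have [B0' B1'] : 0 <= B' /\ B' <= 2 by rewrite ?decay_ge0 ?decay2_le2.
rewrite !normrM normrN (gtr0_norm rV) !ger0_norm//.
have -> : 4 / r = 1 * (2 * r^-1) + 1 * (2 * r^-1) by ring.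
by apply: lerD; apply: ler_pM => //; rewrite ?mulr_ge0 ?ler_pM2r// ltW.
Qed.

End cutoff.

(** * Translation invariance and volume of cubes *)

Section translation_invariance.
Context {R : realType}.

Lemma measurable_shift_rV n (a : 'rV[R]_n) :
  measurable_fun [set: 'rV[R]_n] (fun x => x + a).
Proof.
apply/measurable_fun_rVP => i; under eq_fun do rewrite mxE.
by apply: measurable_funD => //; exact: measurable_coord.
Qed.

Lemma lebesgue_measure_shift (a : R) (A : set R) : measurable A ->
  pushforward (@lebesgue_measure R) (+%R^~ a : R -> measurableTypeR R) A =
  lebesgue_measure A.
Proof.
have ma : measurable_fun [set: measurableTypeR R]
    (+%R^~ a : measurableTypeR R -> measurableTypeR R).
  by apply: measurable_funD.
move=> mA; apply/esym/lebesgue_measure_unique => //= _ [[b c]] _ <-.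
rewrite /pushforward.
have -> : (+%R^~ a) @^-1` `]b, c] = `]b - a, c - a]%classic.
  by apply/seteqP; split => x /=; rewrite !in_itv /= ltrBlDr lerBrDr.
rewrite !lebesgue_measure_itv /= !lte_fin ltrD2r.
by case: ifP => // _; rewrite -!EFinB; congr EFin; ring.
Qed.

(** By induction on the dimension: the image of a product measure under a
product of translations takes the same values on rectangles. *)
Lemma lebesgue_rV_shift n (a : 'rV[R]_n) (A : set 'rV[R]_n) : measurable A ->
  lebesgue_rV n [set x | A (x + a)] = lebesgue_rV n A.
Proof.
elim: n a A => [|n IH] a A mA.
  congr (lebesgue_rV 0 _); apply/seteqP; split=> x /=.
    by rewrite (_ : x + a = x)// -[LHS]/(_ : 'rV_0); apply/rowP => -[].
  by rewrite [x in A x -> _](_ : x = x + a)//; apply/rowP => -[].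
pose tau (y : measurableTypeR R * 'rV[R]_n) : measurableTypeR R * 'rV[R]_n :=
  (y.1 + (tail_rV a).1, y.2 + (tail_rV a).2).
have mtau : measurable_fun setT tau.
  apply: measurable_fun_pair; first by apply: measurable_funD.
  exact: (measurableT_comp (measurable_shift_rV _) measurable_snd).
rewrite /= /lebesgue_step /pushforward.
have mcA : measurable (@cons_rV R n @^-1` A).
  by rewrite -[X in measurable X]setTI; exact: measurable_cons_rV.
rewrite (@product_measure_unique _ _ _ _ _ lebesgue_measure (lebesgue_rV n)
  (pushforward (lebesgue_measure \x lebesgue_rV n)%E tau) _ _ mcA)//.
  congr (product_measure1 _ _ _); apply/seteqP; split=> -[t y] /=.
    move=> h; rewrite /tau /= (_ : cons_rV _ = cons_rV (t, y) + a)//.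
    apply/rowP => i; rewrite !mxE; case: (unliftP ord0 i) => [j ->|->] /=;
      by rewrite ?mxE.
  move=> h; rewrite (_ : cons_rV _ + a = cons_rV (tau (t, y)))//.
  apply/rowP => i; rewrite !mxE; case: (unliftP ord0 i) => [j ->|->] /=;
    by rewrite ?mxE.
move=> B C mB mC; rewrite /= /pushforward.
transitivity (product_measure1 lebesgue_measure (lebesgue_rV n)
  (((+%R^~ (tail_rV a).1) @^-1` B) `*` [set y | C (y + (tail_rV a).2)])) => //.
rewrite product_measure1E//.
- by congr (_ * _)%E; [exact: lebesgue_measure_shift|exact: IH].
- by rewrite -[X in measurable X]setTI; apply: measurable_funD.
- by rewrite -[X in measurable X]setTI; exact: measurable_shift_rV.
Qed.

End translation_invariance.

Section cubes.
Context {R : realType} {n : nat}.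
Local Notation vol := (@lebesgue_rV R n).
Implicit Types (z x : 'rV[R]_n) (r : R).

Lemma continuous_measurable_rV (f : 'rV[R]_n -> R) : continuous f ->
  measurable_fun setT f.
Proof.
move=> /continuousP cf; apply: (measurability _ (RGenOpens.measurableE R)).
move=> _ [_ [a [b ->] <-]]; rewrite setTI; apply: open_measurable_rV.
exact/cf/interval_open.
Qed.

Lemma le_norm_rV x r : 0 <= r -> (forall i, `|x ord0 i| <= r) -> `|x| <= r.
Proof.
move=> r0 xr; rewrite [leLHS]/Num.norm /= mx_normrE; apply/bigmax_leP => /=.
by split=> // -[i j] _; rewrite (ord1 i).
Qed.

Lemma coord_le_norm x i : `|x ord0 i| <= `|x|.
Proof.
rewrite [leRHS]/Num.norm /= mx_normrE; apply/bigmax_geP; right => /=.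
by exists (ord0, i).
Qed.

Lemma measurable_box (A : 'I_n -> set R) : (forall i, measurable (A i)) ->
  measurable [set x : 'rV[R]_n | forall i, A i (x ord0 i)].
Proof.
move=> mA; rewrite (_ : [set x | _] =
    \bigcap_i ((fun x : 'rV[R]_n => x ord0 i) @^-1` A i)).
  apply: fin_bigcap_measurable => // i _; rewrite -[X in measurable X]setTI.
  exact: measurable_coord.
by apply/seteqP; split => x /= h i; [move=> _; exact: h|exact: (h i I)].
Qed.

(** The closed ball of the sup norm, written in coordinates because boxes are
the sets whose volume is known. *)
Definition cube z r : set 'rV[R]_n := [set x | forall i, `|x ord0 i - z ord0 i| <= r].

Lemma cubeE z r :
  cube z r = [set x | forall i, `[z ord0 i - r, z ord0 i + r]%classic (x ord0 i)].
Proof.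
by apply/seteqP; split => x /= h i; have := h i; rewrite ?in_itv/= ler_distl.
Qed.

Lemma measurable_cube z r : measurable (cube z r).
Proof.
rewrite cubeE; apply: (@measurable_box
  (fun i => `[z ord0 i - r, z ord0 i + r]%classic)) => i.
exact: measurable_itv.
Qed.

Lemma vol_cube z r : 0 <= r -> vol (cube z r) = ((2 * r) ^+ n)%:E.
Proof.
move=> r0; rewrite cubeE (@lebesgue_rV_box _ _
  (fun i => `[z ord0 i - r, z ord0 i + r]%classic)); last first.
  by move=> i; exact: measurable_itv.
have h i : lebesgue_measure `[z ord0 i - r, z ord0 i + r] = (2 * r)%:E.
  rewrite lebesgue_measure_itv /= lte_fin.
  case: ltP => h; last by congr EFin; lra.
  by rewrite -EFinB; congr EFin; ring.
rewrite (eq_bigr (fun=> (2 * r)%:E)) => [|i _]; last exact: h.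
rewrite -[n in RHS]card_ord -prodr_const.
by apply: (big_ind2 (fun a b => a = b%:E)) => // a b c d -> ->; rewrite EFinM.
Qed.

Lemma closed_cube z r : closed (cube z r).
Proof.
rewrite (_ : cube z r = \bigcap_i
    ((fun x : 'rV[R]_n => `|x ord0 i - z ord0 i|) @^-1` [set t | t <= r])).
  apply: closed_bigI => i _.
  have cf : continuous (fun x : 'rV[R]_n => `|x ord0 i - z ord0 i|).
    move=> x; apply: (@continuous_comp _ _ _ (fun y : 'rV[R]_n => y ord0 i)
      (fun t : R => `|t - z ord0 i|)); first exact: coord_continuous.
    by apply: cvg_norm; apply: cvgB; [exact: cvg_id|exact: cvg_cst].
  exact: (closed_comp (fun x _ => cf x) (@closed_le _ r)).
by apply/seteqP; split => x /= h i; [move=> _; exact: h|exact: (h i I)].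
Qed.

Lemma bounded_cube (A : set 'rV[R]_n) : bounded_set A ->
  exists2 M, 0 < M & A `<=` cube 0 M.
Proof.
move=> [M [_ AM]]; exists (Num.max M 0 + 1).
  by rewrite ltr_wpDl// le_max lexx orbT.
move=> x Ax i; rewrite mxE subr0; apply: le_trans (coord_le_norm _ _) _.
by apply: AM => //; rewrite ltr_pwDr// le_max lexx.
Qed.

Lemma cube_bounded z r (A : set 'rV[R]_n) : A `<=` cube z r -> bounded_set A.
Proof.
move=> Az; exists (`|z| + `|r|); split; first exact: num_real.
move=> M Mz x /Az xz; apply: ltW; apply: le_lt_trans Mz.
apply: le_norm_rV => [|i]; first by rewrite addr_ge0.
rewrite -[x ord0 i](subrK (z ord0 i)) addrC.
apply: le_trans (ler_normD _ _) _; rewrite lerD ?coord_le_norm//.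
by apply: le_trans (xz i) _; exact: ler_norm.
Qed.

Lemma compact_cube z r : compact (cube z r).
Proof.
apply: bounded_closed_compact; last exact: closed_cube.
exact: (@cube_bounded z r).
Qed.

Lemma vol_bounded_lty (A : set 'rV[R]_n) : measurable A -> bounded_set A ->
  (vol A < +oo)%E.
Proof.
move=> mA /bounded_cube[M M0 AM].
apply: (@le_lt_trans _ _ (vol (cube 0 M))).
  by apply: le_measure => //; rewrite inE//; exact: measurable_cube.
by rewrite vol_cube ?ltry// ltW.
Qed.

Lemma vol_open_gt0 (A : set 'rV[R]_n) : open A -> A !=set0 -> (0 < vol A)%E.
Proof.
move=> oA [x Ax].
have /nbhs_ballP[r /= r0 rA] : nbhs x A by exact: open_nbhs_nbhs.
apply: (@lt_le_trans _ _ (vol (cube x (r / 2)))).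
  rewrite vol_cube ?lte_fin ?exprn_gt0// ?divr_ge0 ?ltW//.
  by rewrite mulrC divfK.
apply: le_measure; rewrite ?inE//.
- exact: measurable_cube.
- exact: open_measurable_rV.
move=> y xy; apply: rA; split => // i j; rewrite (ord1 i).
rewrite -ball_normE /ball_ /= distrC; apply: le_lt_trans (xy j) _.
by rewrite ltr_pdivrMr// ltr_pMr// ltr1n.
Qed.

End cubes.

(** * Integrals of partial derivatives *)

Section mean_value.
Context {R : realType} {n : nat}.
Implicit Types (f g : 'rV[R]_n -> R) (i : 'I_n) (x : 'rV[R]_n).
Local Notation e i := (delta_mx ord0 i : 'rV[R]_n).
Local Notation vol := (@lebesgue_rV R n).

Lemma is_derive_along f x v (t d : R) : is_derive (t *: v + x) v f d ->
  is_derive t (1 : R) (fun s : R => f (s *: v + x)) d.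
Proof.
move=> /is_derive_line df; apply/is_derive_line.
rewrite (_ : (fun h : R => _) = (fun h : R => f (h *: v + (t *: v + x))))//.
by apply/funext => h; rewrite scalerDl addrA [h%:A]mulr1.
Qed.

Lemma partial_MVT i f x (h : R) : (forall x, derivable f x (e i)) ->
  exists2 s, `|s| <= `|h| & f (h *: e i + x) - f x = partial i f (s *: e i + x) * h.
Proof.
move=> df.
have dl t : is_derive t (1 : R) (fun s : R => f (s *: e i + x)) (partial i f (t *: e i + x)).
  by apply: is_derive_along; exact: derivableP.
have cl : continuous (fun s : R => f (s *: e i + x)).
  move=> t; apply/differentiable_continuous/derivable1_diffP.
  by have [] := dl t.
have -> : f x = f (0 *: e i + x) by rewrite scale0r add0r.
have [h0|h0] := leP 0 h.
  have [//|s] := MVT_segment h0 (fun t _ => dl t).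
    exact: continuous_subspaceT.
  rewrite in_itv /= subr0 => /andP[s0 sh] E; exists s => //.
  by rewrite !ger0_norm.
have [//|s] := MVT_segment (ltW h0) (fun t _ => dl t).
  exact: continuous_subspaceT.
rewrite in_itv /= sub0r => /andP[hs s0] E; exists s.
  by rewrite !ler0_norm ?lerN2// ltW.
by rewrite -opprB E mulrN opprK.
Qed.

Lemma continuous_bounded_cube f z r : continuous f ->
  exists2 B, 0 <= B & forall x, cube z r x -> `|f x| <= B.
Proof.
move=> cf.
have [z0|z0] := pselect (cube z r !=set0); last first.
  by exists 0 => // x zx; exfalso; apply: z0; exists x.
have [|||c cz fc] := @EVT_max_rV R n (fun x => `|f x|) (cube z r).
- exact: z0.
- exact: compact_cube.
- by apply: continuous_subspaceT => x; exact: (continuous_comp (cf x) (@norm_continuous _ _ (f x))).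
by exists `|f c| => // x xz; apply: fc; rewrite inE.
Qed.

End mean_value.

Section compactly_supported_integrals.
Context {R : realType} {n : nat}.
Implicit Types (f g : 'rV[R]_n -> R) (i : 'I_n) (x : 'rV[R]_n).
Local Notation e i := (delta_mx ord0 i : 'rV[R]_n).
Local Notation vol := (@lebesgue_rV R n).

Definition vanishes_off (M : R) f := forall x, ~ cube 0 M x -> f x = 0.

Lemma vanishes_offM M f g : vanishes_off M g -> vanishes_off M (f \* g).
Proof. by move=> gM x /gM /= ->; rewrite mulr0. Qed.

Lemma partial_vanishes_off M f i : vanishes_off M f -> vanishes_off M (partial i f).
Proof.
move=> fM x xM; rewrite /partial.
rewrite (@near_eq_derive _ _ _ f (cst 0)) ?derive_cst//.
have : nbhs x (~` cube 0 M).
  by apply: open_nbhs_nbhs; split=> //; apply: closed_openC; exact: closed_cube.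
by apply: filterS => y /fM.
Qed.

Lemma integrable_vanishes_off M f : 0 <= M -> continuous f -> vanishes_off M f ->
  vol.-integrable setT (EFin \o f).
Proof.
move=> M0 cf fM.
have mc : measurable (@cube R n 0 M) by exact: measurable_cube.
have [B _ fB] := continuous_bounded_cube 0 M cf.
have : vol.-integrable (cube 0 M) (EFin \o f).
  apply: measurable_bounded_integrable => //.
  - by have := @vol_cube R n 0 M M0 => /= ->; rewrite ltry.
  - by apply: measurable_funTS; exact: continuous_measurable_rV.
  - exists B; split; first exact: num_real.
    by move=> C BC x xM; apply: le_trans (fB _ xM) (ltW BC).
move=> /(integrable_mkcond _ mc); congr (_.-integrable _ _).
apply/funext => x; rewrite patchE; case: ifPn => //= /negP xM.
by rewrite fM// => /mem_set.
Qed.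

Lemma cube_shift (x a : 'rV[R]_n) M : cube 0 M (x + a) -> cube 0 (M + `|a|) x.
Proof.
move=> h i; have := h i; rewrite !mxE !subr0 => hi.
rewrite -[x ord0 i](addrK (a ord0 i)); apply: le_trans (ler_normB _ _) _.
by rewrite lerD// coord_le_norm.
Qed.

Lemma continuous_shift f a : continuous f -> continuous (fun x => f (x + a)).
Proof.
move=> cf x; have ca : {for x, continuous (fun y : 'rV[R]_n => y + a)}.
  exact: (continuousD (@cvg_id _ (nbhs x)) (@cst_continuous _ _ a x)).
exact: (continuous_comp ca (cf (x + a))).
Qed.

Lemma integral_shift_vanishes_off M f a : 0 <= M -> continuous f ->
  vanishes_off M f -> (\int[vol]_x (f (x + a))%:E = \int[vol]_x (f x)%:E)%E.
Proof.
move=> M0 cf fM.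
have ms := measurable_shift_rV a.
have csh := @continuous_shift f a cf.
have ish : vol.-integrable setT (EFin \o (fun x => f (x + a))).
  apply: (@integrable_vanishes_off (M + `|a|)) => //; first by rewrite addr_ge0.
  by move=> x xM; apply: fM; apply: contra_not xM; exact: cube_shift.
transitivity (\int[pushforward vol (fun x : 'rV[R]_n => (x + a)%R)]_x (f x)%:E)%E.
  rewrite integral_pushforward//.
  by apply/measurable_EFinP; exact: continuous_measurable_rV.
by apply: eq_measure_integral => A mA _; exact: lebesgue_rV_shift.
Qed.

(** Difference quotients of f integrate to 0 by translation invariance. They are
bounded by the maximum of the partial derivative and supported in a fixed cube,
so dominated convergence applies. *)
Lemma integral_partial_eq0 M f i : 0 <= M ->
  (forall x, derivable f x (e i)) -> continuous f -> continuous (partial i f) ->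
  vanishes_off M f -> (\int[vol]_x (partial i f x)%:E = 0)%E.
Proof.
move=> M0 df cf cpf fM.
pose h k : R := k.+1%:R^-1.
have h0 k : 0 < h k by rewrite invr_gt0.
have h1 k : h k <= 1 by rewrite invf_le1// ler1n.
pose q k x : R := (h k)^-1 * (f (x + h k *: e i) - f x).
have pfM := @partial_vanishes_off M f i fM.
have [B B0 fB] := continuous_bounded_cube 0 (M + 1) cpf.
have {}fB x : `|partial i f x| <= B.
  have [/fB//|xM] := pselect (cube 0 (M + 1) x); rewrite pfM ?normr0//.
  by apply: contra_not xM => xM j; rewrite (le_trans (xM j))// lerDl.
have csh k := @continuous_shift f (h k *: e i) cf.
have e1 k : `|h k *: e i| <= 1.
  apply: le_norm_rV => // j; rewrite !mxE /= normrM (gtr0_norm (h0 k)).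
  by apply: mulr_ile1 => //; [exact: ltW|rewrite normr_nat; case: (j == i)].
have shM k : vanishes_off (M + 1) (fun x => f (x + h k *: e i)).
  move=> x xM; apply: fM; apply: contra_not xM => /cube_shift xM j.
  by rewrite (le_trans (xM j))// lerD2l.
have fM1 : vanishes_off (M + 1) f.
  move=> x xM; apply: fM; apply: contra_not xM => xM j.
  by rewrite (le_trans (xM j))// lerDl.
have M10 : 0 <= M + 1 by rewrite addr_ge0.
have ish k := integrable_vanishes_off M10 (csh k) (shM k).
have if_ := integrable_vanishes_off M10 cf fM1.
have q0 k : (\int[vol]_x (q k x)%:E = 0)%E.
  under eq_integral do rewrite /q EFinM EFinB.
  rewrite integralZl//; last exact: (integrableB _ (ish k) if_).
  rewrite integralB_EFin// (@integral_shift_vanishes_off M)// subee ?mule0//.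
  exact: integrable_fin_num.
have mc : measurable (@cube R n 0 (M + 1)) by exact: measurable_cube.
have [] := @dominated_convergence _ _ _ vol setT measurableT
  (fun k x => (q k x)%:E) (fun x => (partial i f x)%:E)
  ((EFin \o cst B) \_ (cube 0 (M + 1))).
- move=> k; apply/measurable_EFinP; apply: continuous_measurable_rV.
  apply: continuous_mulf; first exact: cst_continuous.
  by move=> x; exact: (continuousB (csh k x) (cf x)).
- by apply/measurable_EFinP; exact: continuous_measurable_rV.
- apply: aeW => x _; apply/cvg_EFin; first by near=> k.
  have : (fun t : R => t^-1 * (f (x + t *: e i) - f x)) t @[t --> 0^'] --> partial i f x.
    have : (t^-1 *: (f (t *: e i + x) - f x)) @[t --> (0 : R)^'] --> partial i f x.
      exact: df.
    by under eq_fun do rewrite [_ + x]addrC.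
  move=> /cvgr_dnbhsP; apply; split=> [k|]; first by rewrite gt_eqF.
  exact: cvg_harmonic.
- apply: (integrable_mkcond _ mc).1.
  apply: measurable_bounded_integrable => //.
    by have := @vol_cube R n 0 _ M10 => /= ->; rewrite ltry.
  exists B; split; first exact: num_real.
  by move=> C BC x _; rewrite /= ger0_norm// ltW.
- apply: aeW => x k _; rewrite patchE; case: ifPn => [_|/negP xM].
    rewrite /= lee_fin /q; have [s _ E] := partial_MVT x (h k) df.
    rewrite [x + _]addrC E normrM normfV mulrC normrM mulfK ?fB//.
    by rewrite normr_eq0 gt_eqF.
  have {}xM : ~ cube 0 (M + 1) x by move=> /mem_set.
  by rewrite /q /= shM// fM1// subrr mulr0 normr0.
move=> _ _.
under eq_fun do rewrite q0.
move=> /cvg_lim <- //; apply/cvg_lim => //; exact: cvg_cst.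
Unshelve. all: by end_near. Qed.

End compactly_supported_integrals.

(** * Test functions and integration by parts *)

Section geometric_tails.
Context {R : realType}.
Implicit Types (u : nat -> R) (C : R).

Lemma geometric_partial_sum u C m k : (forall j, `|u j| <= C / 2 ^+ j) ->
  `|series u (m + k)%N - series u m| <= 2 * C / 2 ^+ m - 2 * C / 2 ^+ (m + k).
Proof.
move=> uC; elim: k => [|k IH]; first by rewrite addn0 !subrr normr0.
rewrite addnS seriesSr.
rewrite (_ : _ - _ = (series u (m + k)%N - series u m) + u (m + k)%N); last by ring.
apply: le_trans (ler_normD _ _) _; apply: le_trans (lerD IH (uC _)) _.
rewrite exprS invfM; lra.
Qed.

Lemma geometric_series_cvg u C : (forall j, `|u j| <= C / 2 ^+ j) ->
  cvgn (series u).
Proof.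
move=> uC; apply: normed_cvg.
apply: (@series_le_cvg _ _ (geometric C 2^-1)).
- by move=> k; exact: normr_ge0.
- move=> k; apply: le_trans (normr_ge0 (u k)) _.
  by rewrite /geometric /= exprVn; exact: uC.
- by move=> k; rewrite /geometric /= exprVn; exact: uC.
- by apply: is_cvg_geometric_series; rewrite ger0_norm ?invr_ge0// invf_lt1// ltr1n.
Qed.

(** Uniformity of the convergence: the bound on the remainder depends only on C
and m. *)
Lemma geometric_tail u C m : (forall j, `|u j| <= C / 2 ^+ j) ->
  `|limn (series u) - series u m| <= 2 * C / 2 ^+ m.
Proof.
move=> uC; have cu := geometric_series_cvg uC.
have C0 : 0 <= C by have := le_trans (normr_ge0 _) (uC 0%N); rewrite expr0 divr1.
have cn : (`|series u k - series u m|) @[k --> \oo] --> `|limn (series u) - series u m|.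
  by apply: cvg_norm; apply: cvgB; [exact: cu|exact: cvg_cst].
rewrite -(cvg_lim _ cn)//; apply: limr_le; first by apply/cvg_ex; eexists; exact: cn.
near=> k; have mk : (m <= k)%N by near: k; exact: nbhs_infty_ge.
rewrite -(subnKC mk); apply: le_trans (geometric_partial_sum m _ uC) _.
by rewrite gerBl ?divr_ge0 ?mulr_ge0 ?exprn_ge0.
Unshelve. all: by end_near. Qed.

Lemma geometric_series_bound u C m : (forall j, `|u j| <= C / 2 ^+ j) ->
  `|series u m| <= 2 * C.
Proof.
move=> uC; have C0 : 0 <= C by have := le_trans (normr_ge0 _) (uC 0%N); rewrite expr0 divr1.
have := geometric_partial_sum 0 m uC.
rewrite add0n {2}/series /= big_geq// subr0 expr0 divr1 => /le_trans; apply.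
by rewrite gerBl ?divr_ge0 ?mulr_ge0 ?exprn_ge0.
Qed.

Lemma geometric_sum_bound u C : (forall j, `|u j| <= C / 2 ^+ j) ->
  `|limn (series u)| <= 2 * C.
Proof.
move=> uC; have := geometric_tail 0 uC.
by rewrite /series /= big_geq// subr0 expr0 divr1.
Qed.

End geometric_tails.

Section finite_measure_integrals.
Local Open Scope ereal_scope.
Context d (T : measurableType d) (R : realType)
  (m : {measure set T -> \bar R}) (D : set T).
Hypotheses (mD : measurable D) (Doo : m D < +oo).
Implicit Types (f : T -> R) (B : R).

Lemma integrable_bounded f B : measurable_fun D f ->
  (forall x, D x -> (`|f x| <= B)%R) -> m.-integrable D (EFin \o f).
Proof.
move=> mf fB; apply: measurable_bounded_integrable => //.
exists B; split; first exact: num_real.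
by move=> C BC x Dx; apply: le_trans (fB x Dx) (ltW BC).
Qed.

Lemma bounded_cvg_integral (f_ : nat -> T -> R) f B :
  (forall k, measurable_fun D (f_ k)) ->
  (forall x, D x -> f_ ^~ x @ \oo --> f x) ->
  (forall k x, D x -> (`|f_ k x| <= B)%R) ->
  \int[m]_(x in D) (f_ k x)%:E @[k --> \oo] --> \int[m]_(x in D) (f x)%:E.
Proof.
move=> mf cf fB.
have mf' : measurable_fun D f by apply: measurable_fun_cvg cf.
have [] := @dominated_convergence _ _ _ m D mD
  (fun k x => (f_ k x)%:E) (fun x => (f x)%:E) (cst B%:E) => //.
- by move=> k; apply/measurable_EFinP.
- exact/measurable_EFinP.
- apply: aeW => x Dx; apply/cvg_EFin; first by near=> k.
  exact: cf.
- apply: (@integrable_bounded (cst B) `|B|%R) => //.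
- by apply: aeW => x k Dx; rewrite /= lee_fin fB.
Unshelve. all: by end_near. Qed.

End finite_measure_integrals.

Section test_functions.
Context {R : realType} {n : nat}.
Implicit Types (f phi : 'rV[R]_n -> R) (i : 'I_n) (x : 'rV[R]_n).
Local Notation vol := (@lebesgue_rV R n).
Variable Om : set 'rV[R]_n.

Lemma test_function_sub phi (K : set 'rV[R]_n) : smooth phi -> compact K ->
  [set x | phi x != 0] `<=` K -> K `<=` Om -> test_function Om phi.
Proof.
move=> sphi cK phiK KOm.
have clK : closed K by apply: compact_closed cK; exact: norm_hausdorff.
have supK : closure [set x | phi x != 0] `<=` K.
  by rewrite [X in _ `<=` X](closure_id _).1//; exact: closure_subset.
split=> //; last exact: subset_trans KOm.
exact: subclosed_compact (@closed_closure _ _) cK supK.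
Qed.

Lemma test_function_cst0 : test_function Om (fun=> 0).
Proof.
apply: (@test_function_sub _ set0) => //; [exact: smooth_cst|exact: compact0|].
by move=> x /=; rewrite eqxx.
Qed.

Lemma test_functionD phi psi : test_function Om phi -> test_function Om psi ->
  test_function Om (phi \+ psi).
Proof.
move=> [sphi cphi phiOm] [spsi cpsi psiOm].
apply: (test_function_sub (smoothD sphi spsi) (compactU cphi cpsi)).
  move=> x /=; have [->|phi0] := eqVneq (phi x) 0.
    by rewrite add0r => psi0; right; exact: subset_closure.
  by move=> _; left; exact: subset_closure.
by move=> x [/phiOm|/psiOm].
Qed.

Lemma test_functionZ (c : R) phi : test_function Om phi ->
  test_function Om (fun x => c * phi x).
Proof.
move=> [sphi cphi phiOm]; apply: (test_function_sub (smooth_scale c sphi) cphi) => //.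
move=> x /=; rewrite mulf_eq0 negb_or => /andP[_ phi0].
exact: subset_closure.
Qed.

Lemma test_function_sum (I : Type) (r : seq I) (P : pred I)
    (F : I -> 'rV[R]_n -> R) : (forall j, P j -> test_function Om (F j)) ->
  test_function Om (fun x => \sum_(j <- r | P j) F j x).
Proof.
move=> tF; rewrite (_ : (fun x => _) = \sum_(j <- r | P j) F j).
  apply: (big_ind (fun f => test_function Om f)) => //.
    exact: test_function_cst0.
  exact: test_functionD.
by apply/funext => x; rewrite fct_sumE.
Qed.

Lemma test_function_vanishes_off phi : test_function Om phi ->
  exists2 M, 0 <= M & vanishes_off M phi.
Proof.
move=> [_ /compact_bounded/bounded_cube[M M0 sM] _]; exists M; first exact: ltW.
move=> x xM; apply/eqP; apply: contra_notT xM => phi0.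
exact/sM/subset_closure.
Qed.

Lemma test_function_out phi i x : test_function Om phi -> ~ Om x ->
  phi x = 0 /\ partial i phi x = 0.
Proof.
move=> [_ _ phiOm] Omx.
have xs : ~ closure [set x | phi x != 0] x by move/phiOm.
split; first by apply/eqP; apply: contra_notT xs => ?; exact: subset_closure.
rewrite /partial (@near_eq_derive _ _ _ phi (cst 0)) ?derive_cst//.
have : nbhs x (~` closure [set x | phi x != 0]).
  by apply: open_nbhs_nbhs; split=> //; apply: closed_openC; exact: closed_closure.
apply: filterS => y /= ys; apply/eqP; apply: contra_notT ys => ?.
exact: subset_closure.
Qed.

Lemma test_function_bounded phi : test_function Om phi ->
  exists2 B, 0 <= B & forall x, `|phi x| <= B /\ forall i, `|partial i phi x| <= B.
Proof.
move=> tphi; have [M M0 phiM] := test_function_vanishes_off tphi.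
have [sphi _ _] := tphi.
have [B B0 phiB] := continuous_bounded_cube 0 M (smooth_continuous sphi).
have /choice[C phiC] i : exists C, 0 <= C /\ forall x, cube 0 M x -> `|partial i phi x| <= C.
  have [C C0 phiC] := continuous_bounded_cube 0 M (smooth_continuous (smooth_partial i sphi)).
  by exists C.
have sC i : C i <= \sum_j C j.
  by rewrite (bigD1 i)//= lerDl sumr_ge0// => j _; case: (phiC j).
have sC0 : 0 <= \sum_j C j by apply: sumr_ge0 => j _; case: (phiC j).
exists (B + \sum_i C i); first by rewrite addr_ge0.
move=> x; have [xM|xM] := pselect (cube 0 M x).
  split=> [|i]; first by rewrite (le_trans (phiB _ xM))// lerDl.
  by rewrite (le_trans ((phiC i).2 _ xM))// (le_trans (sC i))// lerDr.
split=> [|i]; first by rewrite phiM// normr0 addr_ge0.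
by rewrite (partial_vanishes_off i phiM xM)// normr0 addr_ge0.
Qed.

(** The product f phi has compact support, so the integral of its partial
derivative vanishes; outside Om both integrands are 0. *)
Lemma integral_by_parts f phi i : smooth f -> test_function Om phi ->
  (\int[vol]_(x in Om) (f x * partial i phi x)%:E =
   - \int[vol]_(x in Om) (partial i f x * phi x)%:E)%E.
Proof.
move=> sf tphi; have [M M0 phiM] := test_function_vanishes_off tphi.
have [sphi _ _] := tphi.
have cf := smooth_continuous sf; have cphi := smooth_continuous sphi.
have cpf := smooth_continuous (smooth_partial i sf).
have cpphi := smooth_continuous (smooth_partial i sphi).
have restr (h : 'rV[R]_n -> R) : (forall x, ~ Om x -> h x = 0) ->
    (\int[vol]_(x in Om) (h x)%:E = \int[vol]_x (h x)%:E)%E.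
  move=> h0; rewrite integral_mkcond; apply: eq_integral => x _.
  rewrite patchE; case: ifPn => // /negP xOm; rewrite h0//.
  by move=> /mem_set.
rewrite !restr; last 2 first.
- by move=> x /(test_function_out i tphi)[-> _]; rewrite mulr0.
- by move=> x /(test_function_out i tphi)[_ ->]; rewrite mulr0.
have i1 : vol.-integrable setT (EFin \o (f \* partial i phi)).
  apply: (integrable_vanishes_off M0); first exact: continuous_mulf.
  exact/vanishes_offM/partial_vanishes_off.
have i2 : vol.-integrable setT (EFin \o (partial i f \* phi)).
  apply: (integrable_vanishes_off M0); first exact: continuous_mulf.
  exact: vanishes_offM.
have df x : derivable f x (delta_mx ord0 i) by exact: smooth_derivable.
have dphi x : derivable phi x (delta_mx ord0 i) by exact: smooth_derivable.
have E : (\int[vol]_x ((f \* partial i phi) x)%:E +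
        \int[vol]_x ((partial i f \* phi) x)%:E = 0)%E.
  rewrite -[LHS]integralD_EFin//.
  rewrite -[RHS](@integral_partial_eq0 R n M (f \* phi) i M0).
  - by apply: eq_integral => x _; rewrite partialM//= [phi x * _]mulrC.
  - by move=> x; exact: derivableM.
  - exact: continuous_mulf.
  - rewrite partialM//; apply: continuous_addf; exact: continuous_mulf.
  - exact: vanishes_offM.
have fin2 := integrable_fin_num measurableT i2.
by rewrite -[LHS](addeK _ fin2) [X in (X - _)%E]E sub0e.
Qed.

End test_functions.

(** * Volume of the collar of a smooth boundary *)

Section lipschitz.
Context {R : realType} {n : nat}.
Implicit Types (f : 'rV[R]_n -> R) (x y z : 'rV[R]_n) (r : R).
Local Notation e i := (delta_mx ord0 i : 'rV[R]_n).

(** Changing the coordinates one at a time joins x to y by n segments parallel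
to the axes, on each of which the mean value theorem applies. The intermediate
points of partial_MVT stay in the cube of radius 3 rho. *)
Lemma smooth_lipschitz_cube f z rho : smooth f ->
  exists2 L, 0 <= L & forall x y r, cube z rho x -> cube z rho y ->
    cube x r y -> `|f y - f x| <= L * r.
Proof.
move=> sf.
have /choice[B fB] i : exists B, 0 <= B /\
    forall x, cube z (3 * rho) x -> `|partial i f x| <= B.
  have [B B0 fB] := continuous_bounded_cube z (3 * rho)
    (smooth_continuous (smooth_partial i sf)).
  by exists B.
exists (\sum_i B i); first by apply: sumr_ge0 => i _; case: (fB i).
move=> x y r zx zy xy.
(* w k has its first k coordinates from y and the others from x. *)
pose w (k : nat) : 'rV[R]_n := \row_j (if (j < k)%N then y ord0 j else x ord0 j).
have w0 : w 0%N = x by apply/rowP => j; rewrite mxE.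
have wn : w n = y by apply/rowP => j; rewrite mxE ltn_ord.
have wS (k : 'I_n) : w k.+1 = (y ord0 k - x ord0 k) *: e k + w k.
  apply/rowP => j; rewrite !mxE /= ltnS leq_eqVlt.
  have [->|jk] := eqVneq j k; first by rewrite eqxx ltnn /= mulr1 subrK.
  by rewrite (negbTE (_ : (j : nat) != k))//= mulr0 add0r.
have -> : f y - f x = \sum_(k < n) (f (w k.+1) - f (w k)).
  by rewrite -w0 -{1}wn -(@telescope_sumr _ 0 n (f \o w))// big_mkord.
apply: le_trans (ler_norm_sum _ _ _) _; rewrite mulr_suml; apply: ler_sum => k _.
have r0 : 0 <= r by exact: le_trans (xy k).
rewrite wS; have [|s sr ->] := @partial_MVT R n k f (w k) (y ord0 k - x ord0 k).
  by move=> u; exact: smooth_derivable.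
have [Bk0 fBk] := fB k.
rewrite normrM ler_pM//; apply: fBk => j; rewrite !mxE eqxx /=.
have wz : `|(if (j < k)%N then y ord0 j else x ord0 j) - z ord0 j| <= rho.
  by case: ifP.
have sk : `|s * (j == k)%:R| <= 2 * rho.
  have [jk|jk] := eqVneq j k; last first.
    by rewrite mulr0 normr0 mulr_ge0// (le_trans _ (zx j)).
  rewrite mulr1; apply: le_trans sr _.
  rewrite (_ : _ - _ = (y ord0 k - z ord0 k) - (x ord0 k - z ord0 k)); last by ring.
  by apply: le_trans (ler_normB _ _) _; have := zx k; have := zy k; lra.
rewrite -addrA; apply: le_trans (ler_normD _ _) _.
by rewrite (_ : 3 * rho = 2 * rho + rho) ?lerD//; ring.
Qed.

Lemma nbhs_cube x (A : set 'rV[R]_n) : nbhs x A ->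
  exists2 rho, 0 < rho & cube x rho `<=` A.
Proof.
move=> /nbhs_ballP[r /= r0 rA]; exists (r / 2); first by rewrite divr_gt0.
move=> y xy; apply: rA; split => // i j; rewrite (ord1 i).
rewrite -ball_normE /ball_ /= distrC; apply: le_lt_trans (xy j) _.
by rewrite ltr_pdivrMr// ltr_pMr// ltr1n.
Qed.

Lemma ball_sub_cube x r : ball x r `<=` cube x r.
Proof.
move=> y [_ /(_ ord0) xy] i; have := xy i.
by rewrite -ball_normE /ball_ /= distrC => /ltW.
Qed.

End lipschitz.

Section translates.
Context {R : realType} {n : nat}.
Local Notation vol := (@lebesgue_rV R n).
Implicit Types (A W : set 'rV[R]_n) (a : 'rV[R]_n).

(** M + 1 disjoint translates of A fit in W, so A has at most the fraction 1 /
(M + 1) of its volume. *)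
Lemma disjoint_translates A W a (M : nat) : measurable A -> measurable W ->
  (forall m x, (m <= M)%N -> A x -> W (x + m%:R *: a)) ->
  (forall m m' x y, (m < m')%N -> A x -> A y ->
    x + m%:R *: a <> y + m'%:R *: a) ->
  (M.+1%:R%:E * vol A <= vol W)%E.
Proof.
move=> mA mW AW dA.
pose T m : set 'rV[R]_n := [set x | A (x + (- (m%:R *: a)))].
have mT m : measurable (T m).
  by rewrite -[X in measurable X]setTI; exact: measurable_shift_rV.
have volT m : vol (T m) = vol A by exact: lebesgue_rV_shift.
have tT : trivIset setT T.
  suff H m m' x : (m < m')%N -> T m x -> T m' x -> False.
    apply/trivIsetP => m m' _ _ mm'; apply/seteqP; split=> // x [Tm Tm'].
    by move: mm'; rewrite neq_ltn => /orP[] mm'; [exact: (H _ _ _ mm' Tm)|exact: (H _ _ _ mm' Tm')].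
  by move=> mm' Tm Tm'; apply: (dA _ _ _ _ mm' Tm Tm'); rewrite !subrK.
rewrite mule_natl; have := @measure_bigsetU _ _ _ vol T mT tT M.+1.
rewrite (eq_bigr (fun=> vol A)) => [|k _]; last exact: volT.
rewrite sumr_const card_ord => volU.
have {}volU : vol (\big[setU/set0]_(i < M.+1) T i) = (vol A *+ M.+1)%E := volU.
rewrite -volU.
have mU : measurable (\big[setU/set0]_(i < M.+1) T i) by exact: bigsetU_measurable.
apply: le_measure; rewrite ?inE// => x; rewrite -bigcup_mkord => -[m /= mM Tm].
by have := AW _ _ mM Tm; rewrite subrK.
Qed.

End translates.

Section collar.
Context {R : realType} {n : nat}.
Local Notation vol := (@lebesgue_rV R n).
Implicit Types (Om A U : set 'rV[R]_n) (x y : 'rV[R]_n) (r : R).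

(** The part of Om in U at distance at most r from the complement has volume at
most C r. Quantifying over measurable subsets A avoids proving that this part is
itself measurable. *)
Definition collar_bound Om U C := forall r A, 0 < r -> measurable A ->
  A `<=` Om -> A `<=` U -> (forall x, A x -> ~ (cube x r `<=` Om)) ->
  (vol A <= (C * r)%:E)%E.

(** Only small r matter: for r > r0 the volume of U is already at most a
constant times r. *)
Lemma collar_bound_large Om U z rho C r0 : 0 < rho -> U `<=` cube z rho -> 0 < r0 ->
  0 <= C ->
  (forall r A, 0 < r -> r <= r0 -> measurable A -> A `<=` Om -> A `<=` U ->
    (forall x, A x -> ~ (cube x r `<=` Om)) -> (vol A <= (C * r)%:E)%E) ->
  exists2 C', 0 <= C' & collar_bound Om U C'.
Proof.
move=> rho0 Uz r00 C0 small.
have V0 : 0 <= (2 * rho) ^+ n by rewrite exprn_ge0// mulr_ge0// ltW.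
exists (C + (2 * rho) ^+ n / r0); first by rewrite addr_ge0// divr_ge0// ltW.
move=> r A r_gt0 mA AOm AU Ar; have [rr0|rr0] := leP r r0.
  apply: le_trans (small r A r_gt0 rr0 mA AOm AU Ar) _.
  by rewrite lee_fin ler_pM2r// lerDl divr_ge0// ltW.
apply: (@le_trans _ _ (vol (cube z rho))).
  by apply: le_measure; rewrite ?inE//; [exact: measurable_cube|exact: subset_trans Uz].
rewrite vol_cube ?lee_fin; last exact: ltW.
apply: (@le_trans _ _ ((2 * rho) ^+ n / r0 * r)).
  by rewrite -mulrA ler_peMr// ler_pdivlMl// mulr1 ltW.
by rewrite ler_pM2r// lerDr.
Qed.

Lemma collar_bound_interior Om x0 : nbhs x0 Om ->
  exists U, [/\ open U, U x0 & exists2 C, 0 <= C & collar_bound Om U C].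
Proof.
move=> /nbhs_cube[rho rho0 zOm].
have r20 : 0 < rho / 2 by rewrite divr_gt0.
exists (ball x0 (rho / 2)); split; [exact: ball_open|exact: ballxx|].
apply: (@collar_bound_large Om _ x0 (rho / 2) 0 (rho / 2)) => //.
  exact: ball_sub_cube.
move=> r A r0 rr mA _ AU Ar; rewrite (_ : A = set0) ?measure0 ?mul0r//.
rewrite -subset0 => x Ax; apply: (Ar _ Ax) => y xy; apply: zOm => i.
have := ball_sub_cube (AU _ Ax) i; have := xy i => h1 h2.
rewrite -(subrK (x ord0 i) (y ord0 i)) -addrA.
by apply: le_trans (ler_normD _ _) _; lra.
Qed.

Lemma cube_col' x y (i : 'I_n) r : cube x r y -> cube (col' i x) r (col' i y).
Proof. by move=> xy j; rewrite !mxE; exact: xy. Qed.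

(** Let h be the signed height above the graph, positive exactly in Om near x0.
It is Lipschitz, so 0 < h <= s on the collar, with s proportional to r.
Translating by s along the direction of the graph increases or decreases h by
exactly s: the successive translates are disjoint, and about 1 / s of them fit
in a bounded cube. *)
Lemma collar_bound_graph Om x0 (i : 'I_n) (b : bool) (gam : 'rV[R]_n.-1 -> R) :
  smooth gam ->
  (\forall x \near x0, Om x <-> 0 < (-1) ^+ b * (x ord0 i - gam (col' i x))) ->
  exists U, [/\ open U, U x0 & exists2 C, 0 <= C & collar_bound Om U C].
Proof.
move=> sgam /nbhs_cube[rho rho0 chart].
pose h x := (-1) ^+ b * (x ord0 i - gam (col' i x)).
have {}chart x : cube x0 rho x -> (Om x <-> 0 < h x) by exact: chart.
have [L L0 gamL] := smooth_lipschitz_cube (col' i x0) rho sgam.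
have r20 : 0 < rho / 2 by rewrite divr_gt0.
have cube0 r r' x : r <= r' -> cube x0 r x -> cube x0 r' x.
  by move=> rr xr j; exact: le_trans (xr j) rr.
exists (ball x0 (rho / 2)); split; [exact: ball_open|exact: ballxx|].
pose V := (2 * (rho / 2 + 1)) ^+ n.
have V0 : 0 <= V by rewrite exprn_ge0// mulr_ge0// addr_ge0// ltW.
apply: (@collar_bound_large Om _ x0 (rho / 2) (V * (1 + L)) (rho / 2)) => //.
- exact: ball_sub_cube.
- by rewrite mulr_ge0// addr_ge0.
move=> r A r0 rr mA AOm AU Ar.
have Acube x : A x -> cube x0 (rho / 2) x by move=> /AU/ball_sub_cube.
have Arho x : A x -> cube x0 rho x.
  by move=> /Acube; apply: cube0; lra.
pose s := (1 + L) * r.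
have s0 : 0 < s by rewrite mulr_gt0// ltr_pwDl.
(* A point of A has a point y outside Om at distance at most r, where h y <= 0. *)
have hA x : A x -> 0 < h x <= s.
  move=> Ax; have hx : 0 < h x by apply/(chart _ (Arho _ Ax)); exact: AOm.
  rewrite hx /=; have /existsNP[y /not_implyP[xy nOy]] := Ar _ Ax.
  have yrho : cube x0 rho y.
    move=> j; rewrite -(subrK (x ord0 j) (y ord0 j)) -addrA.
    have := Acube _ Ax j; have := xy j => h1 h2.
    by apply: le_trans (ler_normD _ _) _; lra.
  have hy : h y <= 0.
    by rewrite leNgt; apply/negP => hy; apply: nOy; apply/(chart _ yrho).
  have := gamL _ _ _ (cube_col' i (Arho _ Ax)) (cube_col' i yrho) (cube_col' i xy).
  have := xy i; rewrite !ler_norml => /andP[h1 h2] /andP[h3 h4].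
  move: hy hx; rewrite /h /s mulrDl; case: (b) => /=; rewrite ?expr1 ?expr0; lra.
(* Hence the translates of A by the multiples of s along e_i are disjoint. *)
pose a : 'rV[R]_n := s *: delta_mx ord0 i.
have ai j m : (m%:R *: a) ord0 j = (j == i)%:R * (m%:R * s).
  by rewrite !mxE eqxx /=; ring.
have hshift x (m : nat) : h (x + m%:R *: a) = h x + (-1) ^+ b * (m%:R * s).
  have -> : h (x + m%:R *: a) = (-1) ^+ b * ((x + m%:R *: a) ord0 i - gam (col' i x)).
    rewrite /h; congr (_ * (_ - gam _)); apply/rowP => j.
    by rewrite !mxE eqxx /= eq_sym (negbTE (neq_lift _ _)) !mulr0 addr0.
  by rewrite mxE ai eqxx mul1r /h; ring.
(* M s <= 1 keeps the translates in the cube of radius rho / 2 + 1, and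
   1 <= (M + 1) s makes their number of the right order. *)
pose M := Num.truncn s^-1.
have Ms : M%:R * s <= 1 by rewrite -ler_pdivlMr// mul1r truncn_le// invr_ge0 ltW.
have M1s : 1 <= M.+1%:R * s by rewrite -ler_pdivrMr// mul1r ltW// truncnS_gt.
have := @disjoint_translates R n A (cube x0 (rho / 2 + 1)) a M mA
  (measurable_cube _ _).
rewrite vol_cube; last by rewrite addr_ge0// ltW.
move=> /(_ _ _)/wrap[||].
- move=> m x mM Ax j; rewrite mxE addrAC ai; apply: le_trans (ler_normD _ _) _.
  rewrite lerD ?Acube//.
  rewrite ger0_norm; last by rewrite !mulr_ge0// ltW// ltr_pwDl.
  case: (j == i); rewrite ?mul0r// mul1r; apply: le_trans _ Ms.
  by rewrite ler_pM2r// ler_nat.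
- move=> m m' x y mm' Ax Ay E.
  have := congr1 h E; rewrite !hshift.
  have /andP[hx1 hx2] := hA _ Ax; have /andP[hy1 hy2] := hA _ Ay.
  have : m%:R * s + s <= m'%:R * s.
    by rewrite -[X in _ + X]mul1r -mulrDl ler_pM2r// natr1 ler_nat.
  by case: (b) => /=; rewrite ?expr1 ?expr0; lra.
move=> MV; have volA : (vol A < +oo)%E.
  by apply: vol_bounded_lty => //; apply: (@cube_bounded _ _ x0 (rho / 2)) => x /Acube.
rewrite -(@fineK _ (vol A)) ?ge0_fin_numE// in MV *.
rewrite -EFinM !lee_fin in MV *.
have vA0 : 0 <= fine (vol A) by rewrite fine_ge0.
rewrite -/V in MV; rewrite -mulrA -/s.
apply: (@le_trans _ _ (fine (vol A) * (M.+1%:R * s))); first by rewrite ler_peMr.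
by rewrite mulrA ler_pM2r// mulrC.
Qed.

(** The local bounds add up over a finite cover of the compact set closure Om.
*)
Lemma collar_volume Om : bounded_smooth_domain Om ->
  exists2 C, 0 <= C & collar_bound Om setT C.
Proof.
move=> [_ oOm _ bOm bdry].
have cK : compact (closure Om).
  have [M M0 OmM] := bounded_cube bOm.
  apply: (subclosed_compact (@closed_closure _ _) (@compact_cube R n 0 M)).
  by rewrite [X in _ `<=` X](closure_id _).1; [exact: closure_subset|exact: closed_cube].
have loc x : exists UC : set 'rV[R]_n * R, closure Om x ->
    [/\ open UC.1, UC.1 x, 0 <= UC.2 & collar_bound Om UC.1 UC.2].
  have [clx|nclx] := pselect (closure Om x); last by exists (set0, 0).
  suff [U [oU Ux [C C0 UC]]] : exists U, [/\ open U, U x &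
      exists2 C, 0 <= C & collar_bound Om U C] by exists (U, C).
  have [intx|nintx] := pselect (interior Om x); first exact: collar_bound_interior.
  have [i [b [gam [sgam chart]]]] := bdry _ (conj clx nintx).
  exact: collar_bound_graph sgam chart.
have {loc}[UC loc] := choice loc.
move: (cK); rewrite compact_cover => /(_ _ (closure Om) (fun x => (UC x).1)).
case=> [x /loc[]//|x clx|D DOm cover].
  by exists x => //; case: (loc x clx).
pose s := finmap.enum_fset D.
have sOm x : x \in s -> closure Om x by move=> /DOm; rewrite inE.
exists (\sum_(x <- s) (UC x).2).
  by rewrite big_seq sumr_ge0// => x /sOm/loc[].
move=> r A r0 mA AOm _ Ar.
have : A `<=` \bigcup_(x in [set` s]) (UC x).1.
  by move=> y /AOm/subset_closure/cover.
elim: s sOm A mA AOm Ar {cover DOm} => [|x s IH] sOm A mA AOm Ar As.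
  rewrite (_ : A = set0) ?measure0 ?big_nil ?mul0r//.
  by rewrite -subset0 => y /As[x].
have [oU Ux C0 UCx] := loc x (sOm _ (mem_head _ _)).
have mU := open_measurable_rV oU.
have -> : A = (A `&` (UC x).1) `|` (A `\` (UC x).1) by rewrite setUIDK.
apply: le_trans (measureU2 _ _ _) _; [exact: measurableI|exact: measurableD|].
rewrite big_cons mulrDl EFinD leeD//.
  apply: UCx => //; first exact: measurableI.
  - by move=> y [/AOm].
  - by move=> y [/Ar].
apply: IH => //.
- by move=> y ys; apply: sOm; rewrite inE ys orbT.
- exact: measurableD.
- by move=> y [/AOm].
- by move=> y [/Ar].
move=> y [Ay nUy]; have [z /=] := As _ Ay; rewrite inE => /orP[/eqP ->//|zs Uz].
by exists z.
Qed.

End collar.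

(** * Membership in the Sobolev space: series and scaling *)

Section power_integrals.
Context {R : realType} {n : nat}.
Implicit Types (Om : set 'rV[R]_n) (f v : 'rV[R]_n -> R) (g : 'rV[R]_n -> 'rV[R]_n).
Local Notation vol := (@lebesgue_rV R n).

Lemma measurable_pow Om f q : measurable_fun Om f ->
  measurable_fun Om (fun x => `|f x| `^ q).
Proof.
move=> mf; apply: (measurableT_comp (measurable_powR q)).
exact: (measurableT_comp (@normr_measurable R setT)).
Qed.

Lemma int_pow_ge0 Om f q : (0 <= int_pow Om q f)%E.
Proof. by apply: integral_ge0 => x _; rewrite lee_fin powR_ge0. Qed.

Lemma int_pow_le Om f q B : measurable Om -> measurable_fun Om f -> 0 <= q ->
  (forall x, Om x -> `|f x| <= B) -> (int_pow Om q f <= (B `^ q)%:E * vol Om)%E.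
Proof.
move=> mOm mf q0 fB; rewrite -integral_cst//.
apply: ge0_le_integral => //.
- by apply/measurable_EFinP; exact: measurable_pow.
- by move=> x Ox; rewrite lee_fin ge0_ler_powR// ?nnegrE// (le_trans _ (fB _ Ox)).
Qed.

Lemma bounded_Lp Om f q B : measurable Om -> (vol Om < +oo)%E ->
  measurable_fun Om f -> 0 <= q -> (forall x, Om x -> `|f x| <= B) -> Lp Om q f.
Proof.
move=> mOm Omoo mf q0 fB; split=> //.
apply: le_lt_trans (int_pow_le mOm mf q0 fB) _.
by rewrite lte_mul_pinfty// lee_fin powR_ge0.
Qed.

Lemma enorm_le (x : 'rV[R]_n) b : 0 <= b -> (forall i, `|x ord0 i| <= b) ->
  enorm x <= n%:R * b.
Proof.
move=> b0 xb; have nb : 0 <= n%:R * b by rewrite mulr_ge0.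
rewrite -[leRHS]ger0_norm// -sqrtr_sqr ler_wsqrtr//.
apply: (@le_trans _ _ (\sum_(i < n) b ^+ 2)).
  by apply: ler_sum => i _; rewrite -real_normK ?num_real// lerXn2r ?nnegrE.
rewrite sumr_const card_ord exprMn -[leLHS]mulr_natl ler_wpM2r ?sqr_ge0//.
by rewrite -natrX ler_nat -mulnn -[leqLHS]muln1 leq_mul2l lt0n orbN.
Qed.

Lemma enorm_ge0 (x : 'rV[R]_n) : 0 <= enorm x.
Proof. exact: sqrtr_ge0. Qed.

Lemma enormZ (c : R) (x : 'rV[R]_n) : enorm (c *: x) = `|c| * enorm x.
Proof.
rewrite /enorm -sqrtr_sqr -sqrtrM ?sqr_ge0//; congr Num.sqrt.
by rewrite mulr_sumr; apply: eq_bigr => i _; rewrite mxE exprMn.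
Qed.

Lemma measurable_enorm Om g : (forall i, measurable_fun Om (fun x => g x ord0 i)) ->
  measurable_fun Om (fun x => enorm (g x)).
Proof.
move=> mg; apply: (@measurableT_comp _ _ _ _ _ _ (@Num.sqrt R)).
  by apply: continuous_measurable_fun; exact: sqrt_continuous.
by apply: measurable_sum => i; exact: measurable_funX.
Qed.

End power_integrals.

Section sobolev_series.
Context {R : realType} {n : nat}.
Local Notation vol := (@lebesgue_rV R n).
Variables (Om : set 'rV[R]_n) (p : R).
Hypotheses (oOm : open Om) (bOm : bounded_set Om) (p1 : 1 <= p).
Variables (psi : nat -> 'rV[R]_n -> R) (C : R).
Hypotheses (tpsi : forall k, test_function Om (psi k))
  (psiC : forall k x, `|psi k x| <= C / 2 ^+ k)
  (dpsiC : forall k i x, `|partial i (psi k) x| <= C / 2 ^+ k).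

Let mOm : measurable Om. Proof. exact: open_measurable_rV. Qed.

Let Omoo : (vol Om < +oo)%E. Proof. exact: vol_bounded_lty. Qed.

Let p0 : 0 <= p. Proof. exact: le_trans p1. Qed.

Definition series_fun x := limn (series (psi ^~ x)).

Definition series_grad x : 'rV[R]_n :=
  \row_i limn (series (fun k => partial i (psi k) x)).

Let S k x := series (psi ^~ x) k.

Let S_test k : test_function Om (S k).
Proof. by apply: test_function_sum => j _; exact: tpsi. Qed.

Let spsi k : smooth (psi k). Proof. by case: (tpsi k). Qed.

Let partial_S i k x : partial i (S k) x = series (fun j => partial i (psi j) x) k.
Proof. by rewrite /S /series /= partial_sum. Qed.

Let S_smooth k : smooth (S k). Proof. by case: (S_test k). Qed.

Let mS k : measurable_fun Om (S k).
Proof.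
by apply: measurable_funTS; apply: continuous_measurable_rV; exact: smooth_continuous.
Qed.

Let mdS i k : measurable_fun Om (partial i (S k)).
Proof.
apply: measurable_funTS; apply: continuous_measurable_rV; apply: smooth_continuous.
exact: smooth_partial.
Qed.

Let cvg_S x : S ^~ x @ \oo --> series_fun x.
Proof. exact: (geometric_series_cvg (psiC ^~ x)). Qed.

Let cvg_dS i x : (fun k => partial i (S k) x) @ \oo --> series_grad x ord0 i.
Proof.
under eq_fun do rewrite partial_S.
by rewrite mxE; exact: (geometric_series_cvg (fun k => dpsiC k i x)).
Qed.

Let mv : measurable_fun Om series_fun.
Proof. by apply: (measurable_fun_cvg mS) => x _; exact: cvg_S. Qed.

Let mg i : measurable_fun Om (fun x => series_grad x ord0 i).
Proof. by apply: (measurable_fun_cvg (mdS i)) => x _; exact: cvg_dS. Qed.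

Let v_bound x : `|series_fun x| <= 2 * C.
Proof. exact: (geometric_sum_bound (psiC ^~ x)). Qed.

Let g_bound i x : `|series_grad x ord0 i| <= 2 * C.
Proof. by rewrite mxE; exact: (geometric_sum_bound (fun k => dpsiC k i x)). Qed.

Let C0 : 0 <= C.
Proof. by have := le_trans (normr_ge0 _) (psiC 0 0); rewrite expr0 divr1. Qed.

(** Integration by parts holds for the partial sums and passes to the limit by
bounded convergence. *)
Lemma series_weak_gradient : weak_gradient Om series_fun series_grad.
Proof.
move=> phi tphi i; have [sphi _ _] := tphi.
have [B B0 phiB] := test_function_bounded tphi.
have mphi : measurable_fun Om phi.
  by apply: measurable_funTS; apply: continuous_measurable_rV; exact: smooth_continuous.
have mdphi : measurable_fun Om (partial i phi).
  apply: measurable_funTS; apply: continuous_measurable_rV; apply: smooth_continuous.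
  exact: smooth_partial.
have c1 : (\int[vol]_(x in Om) (S k x * partial i phi x)%:E @[k --> \oo] -->
    \int[vol]_(x in Om) (series_fun x * partial i phi x)%:E)%E.
  apply: (@bounded_cvg_integral _ _ _ _ _ mOm Omoo _ _ (2 * C * B)).
  - by move=> k; apply: measurable_funM.
  - by move=> x _; apply: cvgM; [exact: cvg_S|exact: cvg_cst].
  - move=> k x _; rewrite normrM ler_pM//.
      exact: (geometric_series_bound k (psiC ^~ x)).
    exact: (phiB x).2.
have c2 : (\int[vol]_(x in Om) (partial i (S k) x * phi x)%:E @[k --> \oo] -->
    \int[vol]_(x in Om) (series_grad x ord0 i * phi x)%:E)%E.
  apply: (@bounded_cvg_integral _ _ _ _ _ mOm Omoo _ _ (2 * C * B)).
  - by move=> k; apply: measurable_funM.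
  - by move=> x _; apply: cvgM; [exact: cvg_dS|exact: cvg_cst].
  - move=> k x _; rewrite normrM ler_pM//; last exact: (phiB x).1.
    by rewrite partial_S; exact: (geometric_series_bound k (fun k => dpsiC k i x)).
rewrite -(cvg_lim _ c1)//; apply/cvg_lim => //.
under eq_fun do rewrite integral_by_parts//.
exact: cvgeN.
Qed.

(** The partial sums are the approximating test functions: they converge
uniformly with their gradients, on a set of finite measure. *)
Lemma W01p_series : W01p Om p series_fun series_grad.
Proof.
split.
  split; first exact: (bounded_Lp mOm Omoo mv p0 (fun x _ => v_bound x)).
  - by move=> i; exact: (bounded_Lp mOm Omoo (mg i) p0 (fun x _ => g_bound i x)).
  - exact: series_weak_gradient.
exists S; split; first exact: S_test.
(* D / 2^k bounds both the remainder of the series and the Euclidean norm of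
   the remainder of the gradients. *)
pose D := 2 * C * (n%:R + 1).
have D0 : 0 <= D by rewrite !mulr_ge0// addr_ge0.
pose K := D `^ (p - 1) * D * fine (vol Om) * 2.
have volE : vol Om = (fine (vol Om))%:E by rewrite fineK// ge0_fin_numE.
have half k : 0 < 2 ^+ k :> R by rewrite exprn_gt0.
have bound (f : 'rV[R]_n -> R) k : measurable_fun Om f ->
    (forall x, Om x -> `|f x| <= D / 2 ^+ k) ->
    (int_pow Om p f <= (D `^ (p - 1) * D * fine (vol Om) / 2 ^+ k)%:E)%E.
  move=> mf fD; apply: le_trans (int_pow_le mOm mf p0 fD) _.
  have t0 : 0 <= D / 2 ^+ k by rewrite divr_ge0// ltW.
  have tD : D / 2 ^+ k <= D by rewrite ler_pdivrMr// ler_peMr// exprn_ege1// ler1n.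
  rewrite volE -EFinM lee_fin -mulr_powRB1// ?(lt_le_trans _ p1)//.
  rewrite [leRHS](_ : _ = D / 2 ^+ k * D `^ (p - 1) * fine (vol Om)); last by ring.
  rewrite ler_wpM2r ?fine_ge0// ler_wpM2l// ge0_ler_powR ?nnegrE//.
  by rewrite subr_ge0.
have b1 k : (int_pow Om p (fun x => (S k x - series_fun x)%R) <=
    (D `^ (p - 1) * D * fine (vol Om) / 2 ^+ k)%:E)%E.
  apply: bound; first exact: measurable_funB.
  move=> x _; rewrite distrC; apply: le_trans (geometric_tail k (psiC ^~ x)) _.
  rewrite ler_pM2r ?invr_gt0//.
  by rewrite /D ler_peMr ?mulr_ge0// lerDr.
have b2 k : (int_pow Om p (fun x => enorm (gradient (S k) x - series_grad x)%R) <=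
    (D `^ (p - 1) * D * fine (vol Om) / 2 ^+ k)%:E)%E.
  apply: bound.
    apply: measurable_enorm => i; under eq_fun do rewrite !mxE.
    apply: measurable_funB; first exact: mdS.
    by have := mg i; under eq_fun do rewrite mxE.
  move=> x _; rewrite ger0_norm ?enorm_ge0//.
  apply: le_trans (@enorm_le _ _ _ (2 * C / 2 ^+ k) _ _) _.
  - by rewrite divr_ge0 ?mulr_ge0// ltW.
  - move=> i; rewrite !mxE distrC partial_S.
    exact: (geometric_tail k (fun k => dpsiC k i x)).
  - rewrite mulrA ler_pM2r ?invr_gt0// /D [leRHS]mulrC ler_wpM2r ?mulr_ge0//.
    by rewrite lerDl.
apply: (@squeeze_cvge _ _ _ _ (cst 0%E) _ (fun k => (K / 2 ^+ k)%:E)).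
- near=> k; rewrite adde_ge0 ?int_pow_ge0//=.
  apply: le_trans (leeD (b1 k) (b2 k)) _.
  by rewrite -EFinD lee_fin /K; lra.
- exact: cvg_cst.
- apply/cvg_EFin; first by near=> k.
  have h : `|2^-1 : R| < 1 by rewrite ger0_norm ?invr_ge0// invf_lt1// ltr1n.
  have := @cvg_geometric R K 2^-1 h.
  by rewrite /geometric /=; under eq_fun do rewrite exprVn.
Unshelve. all: by end_near. Qed.

End sobolev_series.

Section scaling.
Context {R : realType} {n : nat}.
Local Notation vol := (@lebesgue_rV R n).
Variables (Om : set 'rV[R]_n) (p : R).
Hypotheses (mOm : measurable Om) (Omoo : (vol Om < +oo)%E) (p1 : 1 <= p).
Implicit Types (f h v phi : 'rV[R]_n -> R) (g : 'rV[R]_n -> 'rV[R]_n) (c q : R).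

Lemma int_powZ f c q : measurable_fun Om f ->
  int_pow Om q (fun x => c * f x) = ((`|c| `^ q)%:E * int_pow Om q f)%E.
Proof.
move=> mf; rewrite /int_pow -ge0_integralZl//.
- by apply: eq_integral => x _; rewrite normrM powRM.
- by apply/measurable_EFinP; exact: measurable_pow.
Qed.

Lemma LpZ f c : Lp Om p f -> Lp Om p (fun x => c * f x).
Proof.
move=> [mf foo]; split; first exact: measurable_funM.
rewrite int_powZ// lte_mul_pinfty ?lee_fin ?powR_ge0//.
Qed.

(** On a set of finite measure, |f| <= 1 + |f|^p. *)
Lemma Lp_integrable f : Lp Om p f -> vol.-integrable Om (EFin \o f).
Proof.
move=> [mf foo].
have i1 : vol.-integrable Om (EFin \o cst 1).
  by apply: (@integrable_bounded _ _ _ _ _ mOm Omoo (cst 1) `|1|).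
have ip : vol.-integrable Om (EFin \o (fun x => `|f x| `^ p)).
  apply/integrableP; split; first by apply/measurable_EFinP; exact: measurable_pow.
  by under eq_integral do rewrite /= ger0_norm ?powR_ge0//.
apply: le_integrable (integrableD mOm i1 ip) => //; first exact/measurable_EFinP.
move=> x _ /=; rewrite lee_fin [leRHS]ger0_norm ?addr_ge0 ?powR_ge0//.
have [f1|f1] := leP `|f x| 1; first by rewrite (le_trans f1)// lerDl powR_ge0.
by rewrite (le_trans (le1r_powR (ltW f1) p1))// lerDr.
Qed.

Lemma Lp_mul_integrable f h (B : R) : Lp Om p f -> measurable_fun Om h ->
  (forall x, `|h x| <= B) -> vol.-integrable Om (EFin \o (fun x => f x * h x)).
Proof.
move=> Lf mh hB; have [mf _] := Lf.
have iB : vol.-integrable Om (EFin \o (fun x => B * f x)).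
  by have := integrableZl mOm B (Lp_integrable Lf).
apply: le_integrable iB => //.
  by apply/measurable_EFinP; exact: measurable_funM.
move=> x _ /=; rewrite lee_fin !normrM mulrC ler_wpM2r//.
by rewrite (le_trans (hB x))// ler_norm.
Qed.

Lemma weak_gradientZ v g c : Lp Om p v ->
  (forall i, Lp Om p (fun x => g x ord0 i)) -> weak_gradient Om v g ->
  weak_gradient Om (fun x => c * v x) (fun x => c *: g x).
Proof.
move=> Lv Lg wg phi tphi i; have [sphi _ _] := tphi.
have [B B0 phiB] := test_function_bounded tphi.
have mphi : measurable_fun Om phi.
  by apply: measurable_funTS; apply: continuous_measurable_rV; exact: smooth_continuous.
have mdphi : measurable_fun Om (partial i phi).
  apply: measurable_funTS; apply: continuous_measurable_rV; apply: smooth_continuous.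
  exact: smooth_partial.
have i1 := Lp_mul_integrable Lv mdphi (fun x => (phiB x).2 i).
have i2 := Lp_mul_integrable (Lg i) mphi (fun x => (phiB x).1).
under eq_integral do rewrite -mulrA EFinM.
rewrite integralZl// wg//.
under [in RHS]eq_integral do rewrite mxE -mulrA EFinM.
by rewrite integralZl// muleN.
Qed.

Lemma dirichlet_energyZ g c : (forall i, measurable_fun Om (fun x => g x ord0 i)) ->
  dirichlet_energy Om p (fun x => c *: g x) =
  ((`|c| `^ p)%:E * dirichlet_energy Om p g)%E.
Proof.
move=> mg; rewrite /dirichlet_energy -int_powZ; last exact: measurable_enorm.
apply: eq_integral => x _.
by rewrite enormZ !normrM normr_id.
Qed.

(** The infimum defining lambda is over a normalised class, so members of the
Sobolev space have to be rescaled. *)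
Lemma W01pZ v g c : W01p Om p v g -> W01p Om p (fun x => c * v x) (fun x => c *: g x).
Proof.
move=> [[Lv Lg wg] [phi [tphi phiv]]]; split.
  split; [exact: LpZ| |exact: weak_gradientZ].
  by move=> i; under eq_fun do rewrite mxE; exact: LpZ.
exists (fun k x => c * phi k x); split=> [k|]; first exact: test_functionZ.
have [mv _] := Lv; have mg i : measurable_fun Om (fun x => g x ord0 i) by case: (Lg i).
have sphi k : smooth (phi k) by case: (tphi k).
have mphi k : measurable_fun Om (phi k).
  by apply: measurable_funTS; apply: continuous_measurable_rV; exact: smooth_continuous.
have mdphi k i : measurable_fun Om (partial i (phi k)).
  apply: measurable_funTS; apply: continuous_measurable_rV; apply: smooth_continuous.
  exact: smooth_partial.
have E k : (int_pow Om p (fun x => (c * phi k x - c * v x)%R) +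
    int_pow Om p (fun x => enorm (gradient (fun x => (c * phi k x)%R) x - c *: g x)%R) =
    (`|c| `^ p)%:E * (int_pow Om p (fun x => (phi k x - v x)%R) +
    int_pow Om p (fun x => enorm (gradient (phi k) x - g x)%R)))%E.
  rewrite ge0_muleDr ?int_pow_ge0//; congr (_ + _)%E.
    rewrite -int_powZ; last exact: measurable_funB.
    by under eq_fun do rewrite -mulrBr.
  have mD i : measurable_fun Om (fun x => (gradient (phi k) x - g x) ord0 i).
    under eq_fun do rewrite !mxE.
    by apply: measurable_funB; [exact: mdphi|exact: mg].
  rewrite -[RHS](dirichlet_energyZ c mD); apply: eq_integral => x _.
  congr ((`|enorm _| `^ p)%:E); apply/rowP => i; rewrite !mxE partialZ ?mulrBr//.
  by move=> y; exact: smooth_derivable.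
under eq_fun do rewrite E.
have fc : (`|c| `^ p)%:E \is a fin_num by [].
by have := cvgeZl fc phiv; rewrite mule0.
Qed.

End scaling.

(** * Whitney sums of cutoffs *)

Section whitney_cutoffs.
Context {R : realType} {n : nat}.
Local Notation vol := (@lebesgue_rV R n).
Variables (Om : set 'rV[R]_n) (K : nat).
Hypothesis OmK : Om `<=` cube 0 K%:R.

Let side k := ((2 * K).+1 * 2 ^ k)%N.

(** The grid of step 2^-k covering the cube of radius K, which contains Om. *)
Definition node k (j : {ffun 'I_n -> 'I_(side k)}) : 'rV[R]_n :=
  \row_i ((j i)%:R / 2 ^+ k - K%:R).

Arguments node : clear implicits.

Definition level k x := \sum_(j | `[< cube (node k j) (2 / 2 ^+ k) `<=` Om >])
  cutoff (node k j) (2 / 2 ^+ k) x.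

(** There are ((2K+1) 2^k)^n nodes, and the partial derivatives of a cutoff of
radius 2/2^k are at most 2 * 2^k. The weight divides by the product of these two
numbers and by 2^k. *)
Definition weight k : R := ((2 * (2 * K).+1 ^ n)%:R * (2 ^+ k) ^+ n.+2)^-1.

Definition whitney k x := weight k * level k x.

Let half k : 0 < 2 ^+ k :> R. Proof. by rewrite exprn_gt0. Qed.

Lemma weight_gt0 k : 0 < weight k.
Proof. by rewrite invr_gt0 mulr_gt0 ?exprn_gt0// ltr0n muln_gt0 expn_gt0. Qed.

Let side_weight k (t : R) : 0 <= t -> t <= 2 * 2 ^+ k ->
  weight k * ((side k ^ n)%:R * t) <= 1 / 2 ^+ k.
Proof.
move=> t0 tk; rewrite /weight ler_pdivrMl; last first.
  by rewrite mulr_gt0 ?exprn_gt0// ltr0n muln_gt0 expn_gt0.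
pose P : R := (2 * K).+1%:R ^+ n; pose Q : R := (2 ^+ k) ^+ n.
have PQ : 0 <= P * Q by rewrite mulr_ge0// exprn_ge0// ltW.
have -> : (side k ^ n)%:R = P * Q :> R.
  by rewrite natrX natrM natrX exprMn.
have -> : (2 * (2 * K).+1 ^ n)%:R * (2 ^+ k) ^+ n.+2 * (1 / 2 ^+ k) =
    P * Q * (2 * 2 ^+ k).
  rewrite natrM natrX -/P !exprS -/Q; field.
  by rewrite gt_eqF.
exact: ler_wpM2l.
Qed.

Let sum_le k (f : {ffun 'I_n -> 'I_(side k)} -> R) (B : R) (P : pred _) :
  (forall j, `|f j| <= B) -> `|\sum_(j | P j) f j| <= (side k ^ n)%:R * B.
Proof.
move=> fB.
have side0 : (0 < side k)%N by rewrite muln_gt0 expn_gt0.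
have B0 : 0 <= B := le_trans (normr_ge0 _) (fB [ffun=> Ordinal side0]).
apply: le_trans (ler_norm_sum _ _ _) _.
apply: (@le_trans _ _ (\sum_(j | P j) B)); first by apply: ler_sum => j _.
rewrite sumr_const -[leLHS]mulr_natl; apply: ler_wpM2r => //; rewrite ler_nat.
have <- : #|{ffun 'I_n -> 'I_(side k)}| = (side k ^ n)%N by rewrite card_ffun !card_ord.
exact: max_card.
Qed.

Lemma whitney_test k : test_function Om (whitney k).
Proof.
apply: test_functionZ; apply: test_function_sum => j /asboolP jOm.
have r0 : 0 < 2 / 2 ^+ k :> R by rewrite divr_gt0.
apply: (@test_function_sub _ _ _ (cutoff (node k j) (2 / 2 ^+ k)) (cube (node k j) (2 / 2 ^+ k))) => //.
- exact: smooth_cutoff.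
- exact: compact_cube.
by move=> x /= /(cutoff_support r0).
Qed.

Lemma whitney_ge0 k x : 0 <= whitney k x.
Proof.
rewrite mulr_ge0 ?(ltW (weight_gt0 k))// sumr_ge0// => j _.
exact: cutoff_ge0.
Qed.

Lemma whitney_le k x : `|whitney k x| <= 1 / 2 ^+ k.
Proof.
rewrite normrM gtr0_norm ?weight_gt0//.
apply: le_trans (side_weight ler01 _).
  rewrite ler_pM2l ?weight_gt0//; apply: sum_le => j.
  by rewrite ger0_norm ?cutoff_ge0// cutoff_le1.
have := @exprn_ege1 R k 2; rewrite ler1n => /(_ isT); lra.
Qed.

Lemma partial_whitney_le k i x : `|partial i (whitney k) x| <= 1 / 2 ^+ k.
Proof.
have sl : smooth (level k) by apply: smooth_sum => j _; exact: smooth_cutoff.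
have r0 : 0 < 2 / 2 ^+ k :> R by rewrite divr_gt0.
rewrite partialZ; last by move=> y; exact: smooth_derivable.
rewrite normrM gtr0_norm ?weight_gt0// partial_sum; last by move=> j _; exact: smooth_cutoff.
have t0 : 0 <= 2 * 2 ^+ k :> R by rewrite mulr_ge0// ltW.
apply: le_trans (side_weight t0 (lexx _)).
rewrite ler_pM2l ?weight_gt0//; apply: sum_le => j.
apply: le_trans (cutoff_partial_le _ _ _ r0) _.
by rewrite invf_div mulrA le_eqVlt; apply/orP; left; apply/eqP; lra.
Qed.

(** The node just below x in each coordinate is at distance at most 2^-k from x,
so that x is in the core of its cutoff, and the cube of radius 2/2^k around that
node is contained in the cube of radius 3/2^k around x. *)
Lemma whitney_lower k x : Om x -> cube x (3 / 2 ^+ k) `<=` Om ->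
  weight k * expR (- 4) ^+ n <= whitney k x.
Proof.
move=> Ox xOm; rewrite ler_pM2l ?weight_gt0//.
have r0 : 0 < 2 / 2 ^+ k :> R by rewrite divr_gt0.
have xK i : 0 <= (x ord0 i + K%:R) * 2 ^+ k <= (2 * K * 2 ^ k)%:R.
  have := OmK Ox i; rewrite mxE subr0 ler_norml => /andP[h1 h2].
  rewrite mulr_ge0/=; last 2 first.
  - by rewrite -lerBlDr sub0r.
  - exact: ltW.
  rewrite natrM natrX ler_pM2r// natrM; lra.
have js i : (Num.truncn ((x ord0 i + K%:R) * 2 ^+ k) < side k)%N.
  have /andP[h1 h2] := xK i.
  rewrite -(@ltr_nat R); apply: le_lt_trans (le_trans _ h2) _; first by rewrite truncn_le.
  by rewrite ltr_nat /side mulSn -addn1 addnC leq_add2r expn_gt0.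
pose j : {ffun 'I_n -> 'I_(side k)} := [ffun i => Ordinal (js i)].
have jx i : node k j ord0 i <= x ord0 i <= node k j ord0 i + 1 / 2 ^+ k.
  have /andP[h1 _] := xK i.
  rewrite mxE ffunE /=; apply/andP; split.
    by rewrite lerBlDr ler_pdivrMr// truncn_le.
  rewrite addrAC -mulrDl lerBrDr ler_pdivlMr// natr1.
  exact/ltW/truncnS_gt.
have jOm : cube (node k j) (2 / 2 ^+ k) `<=` Om.
  apply: subset_trans xOm => y yj i.
  have /andP[h1 h2] := jx i; have := yj i; rewrite !ler_norml => /andP[h3 h4].
  by apply/andP; split; lra.
rewrite /level (bigD1 j) /=; last exact/asboolP.
apply: le_trans (_ : cutoff (node k j) (2 / 2 ^+ k) x <= _); last first.
  by rewrite lerDl sumr_ge0// => i _; exact: cutoff_ge0.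
apply: cutoff_center => // i; have /andP[h1 h2] := jx i.
have -> : 2 / 2 ^+ k / 2 = 1 / 2 ^+ k :> R by lra.
by rewrite ger0_norm ?subr_ge0// lerBlDl.
Qed.

Lemma weightE k : weight k = weight 0 / (2 ^+ k) ^+ n.+2.
Proof. by rewrite /weight expr0 expr1n mulr1 invfM. Qed.

End whitney_cutoffs.

(** * Square integrability of the logarithm *)

Section layer_cake.
Context d (T : measurableType d) (R : realType)
  (m : {measure set T -> \bar R}) (D : set T).
Hypotheses (mD : measurable D) (Doo : (m D < +oo)%E).

Lemma sum_odd_square k : \sum_(0 <= j < k) (2 * j + 3)%:R = k.+1%:R ^+ 2 - 1 :> R.
Proof.
elim: k => [|k IH]; first by rewrite big_geq// expr1n subrr.
by rewrite big_nat_recr//= IH natrD natrM -!natr1; ring.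
Qed.

Lemma sum_three_quarters k : \sum_(0 <= j < k) (3 / 4) ^+ j <= 4 :> R.
Proof.
have -> : \sum_(0 <= j < k) (3 / 4) ^+ j = 4 * (1 - (3 / 4) ^+ k) :> R.
  elim: k => [|k IH]; first by rewrite big_geq// expr0 subrr mulr0.
  by rewrite big_nat_recr//= IH exprS; field.
have : 0 <= (3 / 4) ^+ k :> R by rewrite exprn_ge0// divr_ge0.
lra.
Qed.

Lemma odd_le_geometric j : (2 * j + 3)%:R <= 4 * (3 / 2) ^+ j :> R.
Proof.
elim: j => [|j IH]; first by rewrite expr0 mulr1 ler_nat.
have h : 1 <= (3 / 2) ^+ j :> R by rewrite exprn_ege1//; lra.
have -> : (2 * j.+1 + 3)%:R = (2 * j + 3)%:R + 2 :> R.
  by rewrite -natrD; congr _%:R; lia.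
by rewrite exprS; lra.
Qed.

(** Let k be the first index with x not in A k. Then x lies in A j for all j < k
and (f x)^2 <= E^2 (k+1)^2, where (k+1)^2 = 1 + sum of the odd numbers 2j+3 for
j < k. Hence f^2 is dominated by E^2 plus the series of E^2 (2j+3) times the
indicator of A j, whose integral is at most a geometric series. *)
Lemma square_integral_layers (f : T -> R) (A : nat -> set T) (C E : R) :
  0 <= C -> 0 <= E -> measurable_fun D f -> (forall k, measurable (A k)) ->
  (forall k, (m (A k) <= (C / 2 ^+ k)%:E)%E) ->
  (forall x, D x -> exists k, ~ A k x) ->
  (forall k x, D x -> ~ A k x -> `|f x| <= E * k.+1%:R) ->
  (\int[m]_(x in D) (f x ^+ 2)%:E < +oo)%E.
Proof.
move=> C0 E0 mf mA mAC Aex Af.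
pose h j x := (E ^+ 2 * (2 * j + 3)%:R * \1_(A j) x)%:E.
have h0 j x : (0 <= h j x)%E by rewrite lee_fin !mulr_ge0// sqr_ge0.
have mh j : measurable_fun D (h j).
  by apply/measurable_EFinP; apply: measurable_funM.
have mH : measurable_fun D (fun x => \sum_(0 <= j <oo) h j x)%E.
  exact: ge0_emeasurable_sum.
have fh x : D x -> ((f x ^+ 2)%:E <= (E ^+ 2)%:E + \sum_(0 <= j <oo) h j x)%E.
  move=> Dx; have exk : exists k, x \notin A k.
    by have [k nAk] := Aex _ Dx; exists k; apply: contra_notN nAk; rewrite inE.
  case: (ex_minnP exk) => k /negP nAk kmin.
  have {}nAk : ~ A k x by move=> /mem_set.
  apply: (@le_trans _ _ ((E ^+ 2)%:E + \sum_(0 <= j < k) h j x)%E); last first.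
    by rewrite leeD2l//; apply: nneseries_lim_ge.
  have -> : (\sum_(0 <= j < k) h j x = (E ^+ 2 * (k.+1%:R ^+ 2 - 1))%:E)%E.
    rewrite -sum_odd_square mulr_sumr -sumEFin.
    rewrite big_nat [RHS]big_nat; apply: eq_bigr => j /= jk.
    rewrite /h indicE mem_set ?mulr1//; apply: contrapT => nAj.
    by have := kmin j; rewrite memNset//= leqNgt jk => /(_ isT).
  rewrite -EFinD lee_fin -[f x ^+ 2]real_normK ?num_real//.
  rewrite -[X in X + _]mulr1 -mulrDr addrC subrK -exprMn.
  by rewrite lerXn2r ?nnegrE ?mulr_ge0// Af.
apply: (@le_lt_trans _ _ (\int[m]_(x in D) ((E ^+ 2)%:E + \sum_(0 <= j <oo) h j x))%E).
  apply: ge0_le_integral => //.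
  - by move=> x _; rewrite lee_fin sqr_ge0.
  - by apply/measurable_EFinP; exact: measurable_funX.
  - exact: emeasurable_funD.
rewrite ge0_integralD//; last 2 first.
- by move=> x _; rewrite lee_fin sqr_ge0.
- by move=> x _; exact: nneseries_ge0.
rewrite integral_cst// integral_nneseries//.
apply: lte_add_pinfty; first by rewrite lte_mul_pinfty ?lee_fin ?sqr_ge0.
have hC j : (\int[m]_(x in D) h j x <= (E ^+ 2 * 4 * C * (3 / 4) ^+ j)%:E)%E.
  rewrite /h; under eq_integral do rewrite EFinM.
  rewrite ge0_integralZl_EFin//; last 2 first.
  - by apply/measurable_EFinP; exact: measurable_indic.
  - by rewrite mulr_ge0 ?sqr_ge0.
  rewrite integral_indic//.
  apply: (@le_trans _ _ ((E ^+ 2 * (2 * j + 3)%:R)%:E * (C / 2 ^+ j)%:E)%E).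
    rewrite lee_wpmul2l ?lee_fin ?mulr_ge0 ?sqr_ge0//.
    apply: le_trans (mAC j); apply: le_measure; rewrite ?inE//.
    exact: measurableI.
  rewrite -EFinM lee_fin.
  have -> : E ^+ 2 * 4 * C * (3 / 4) ^+ j = E ^+ 2 * (4 * (3 / 2) ^+ j) * (C / 2 ^+ j).
    have -> : 3 / 4 = 3 / 2 * 2^-1 :> R by field.
    by rewrite exprMn exprVn; ring.
  rewrite ler_wpM2r ?divr_ge0 ?exprn_ge0// ler_wpM2l ?sqr_ge0//.
  exact: odd_le_geometric.
apply: (@le_lt_trans _ _ (E ^+ 2 * 4 * C * 4)%:E); last exact: ltry.
apply: lime_le.
  by apply: is_cvg_nneseries => j _ _; apply: integral_ge0.
near=> k; apply: (@le_trans _ _ (\sum_(0 <= j < k) (E ^+ 2 * 4 * C * (3 / 4) ^+ j)%:E)%E).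
  by apply: lee_sum => j _; exact: hC.
rewrite sumEFin -mulr_sumr lee_fin ler_wpM2l ?sum_three_quarters//.
by rewrite !mulr_ge0// sqr_ge0.
Unshelve. all: by end_near. Qed.

End layer_cake.

Section log_square.
Context {R : realType} {n : nat}.
Local Notation vol := (@lebesgue_rV R n).

Lemma exists_scale (rho c : R) : 0 < rho -> exists k : nat, c / 2 ^+ k <= rho.
Proof.
move=> rho0; exists (Num.truncn (c / rho)).+1.
rewrite ler_pdivrMr ?exprn_gt0// mulrC -ler_pdivrMr//.
apply: le_trans (ltW (truncnS_gt _)) _.
by rewrite -natrX ler_nat ltnW// ltn_expl.
Qed.

(** The sets A k = {v < beta / 2^(kl)} lie in the collars of width 3/2^k, and
off A k the logarithm of v is bounded by a constant times k + 1. *)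
Lemma log_square_integral (Om : set 'rV[R]_n) (v : 'rV[R]_n -> R) (B beta : R) (l : nat) :
  open Om -> (vol Om < +oo)%E -> measurable_fun Om v -> 0 < beta ->
  (exists2 C, 0 <= C & collar_bound Om setT C) ->
  (forall x, Om x -> 0 < v x <= B) ->
  (forall k x, Om x -> cube x (3 / 2 ^+ k) `<=` Om -> beta / (2 ^+ k) ^+ l <= v x) ->
  (\int[vol]_(x in Om) (ln (v x) ^+ 2)%:E < +oo)%E.
Proof.
move=> oOm Omoo mv beta0 [C C0 collar] vB vlow.
have mOm := open_measurable_rV oOm.
pose A k := Om `&` v @^-1` `]-oo, beta / (2 ^+ k) ^+ l[.
have AE k x : Om x -> (A k x <-> v x < beta / (2 ^+ k) ^+ l).
  by move=> Ox; rewrite /A /= in_itv /=; split=> [[]|].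
pose E := `|ln B| + `|ln beta| + l%:R * ln 2.
have ln20 : 0 <= ln 2 :> R by rewrite ln_ge0// ler1n.
apply: (@square_integral_layers _ _ _ vol Om mOm Omoo _ A (C * 3) E).
- by rewrite mulr_ge0.
- by rewrite /E !addr_ge0 ?mulr_ge0.
- exact: (measurableT_comp (@measurable_ln R)).
- by move=> k; apply: mv => //; exact: measurable_itv.
- move=> k; rewrite -mulrA; apply: collar => //.
  + by apply: mv => //; exact: measurable_itv.
  + by move=> x [].
  + move=> x [Ox vx] /(vlow _ _ Ox); rewrite leNgt => /negP; apply.
    by move: vx; rewrite /= in_itv.
- move=> x Ox; have /nbhs_cube[rho rho0 xOm] : nbhs x Om by exact: open_nbhs_nbhs.
  have [k krho] := exists_scale 3 rho0; exists k => /(AE _ _ Ox).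
  apply/negP; rewrite -leNgt; apply: vlow => // y xy; apply: xOm => i.
  exact: le_trans (xy i) krho.
move=> k x Ox /(AE _ _ Ox)/negP; rewrite -leNgt => vk.
have /andP[v0 vxB] := vB x Ox.
have k0 : 0 < (2 ^+ k) ^+ l :> R by rewrite !exprn_gt0.
have lnvB : ln (v x) <= ln B by rewrite ler_ln ?posrE// (lt_le_trans v0).
have lnvk : ln beta - (l * k)%:R * ln 2 <= ln (v x).
  rewrite mulr_natl -lnXn// mulnC exprM -ln_div ?posrE// ler_ln ?posrE//.
  by rewrite divr_gt0.
have k1 : 1 <= k.+1%:R :> R by rewrite ler1n.
have EB : `|ln B| + `|ln beta| <= (`|ln B| + `|ln beta|) * k.+1%:R.
  by rewrite ler_peMr// addr_ge0.
have El : (l * k)%:R * ln 2 <= l%:R * ln 2 * k.+1%:R :> R.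
  by rewrite natrM mulrAC ler_wpM2l ?mulr_ge0// ler_nat.
rewrite ler_norml /E mulrDl.
have h1 := ler_norm (ln B); have h2 := ler_norm (- ln beta); rewrite normrN in h2.
have h3 : 0 <= l%:R * ln 2 * k.+1%:R :> R by rewrite !mulr_ge0.
have h4 := normr_ge0 (ln B); have h5 := normr_ge0 (ln beta).
by apply/andP; split; lra.
Qed.

End log_square.

(** * Geometric mean and Rayleigh quotients *)

Section real_powers.
Context {R : realType}.
Implicit Types (t a B : R).

(** From exp(-t) >= 1 - t one gets exp t - 1 <= t exp t, hence exp t - 1 - t <=
t (exp t - 1), and the last factor is controlled on each side of 0. *)
Lemma expR_le_quadratic t B : 0 <= B -> t <= B ->
  expR t <= 1 + t + t ^+ 2 * expR B.
Proof.
move=> B0 tB.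
have et1 : expR t - 1 <= t * expR t.
  have := expR_ge1Dx (- t); rewrite expRN => h.
  have := ler_wpM2l (expR_ge0 t) h.
  by rewrite mulfV ?gt_eqF ?expR_gt0//; lra.
have et2 := expR_ge1Dx t.
have eB : expR t <= expR B by rewrite ler_expR.
have eB1 : 1 <= expR B by rewrite -expR0 ler_expR.
rewrite expr2; have [t0|t0] := leP 0 t; nra.
Qed.

(** Young's inequality for the product t * 1 with exponent a. *)
Lemma bernoulli_powR t a : 0 <= t -> 1 <= a -> 1 + a * (t - 1) <= t `^ a.
Proof.
move=> t0; rewrite le_eqVlt => /orP[/eqP <-|a1].
  by rewrite powRr1//; lra.
have a0 : 0 < a by exact: lt_trans a1.
have b0 : 0 < (1 - a^-1)^-1 by rewrite invr_gt0 subr_gt0 invf_lt1.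
have ab : a^-1 + ((1 - a^-1)^-1)^-1 = 1 by rewrite invrK; lra.
have := conjugate_powR t0 (@ler01 R) a0 b0 ab.
rewrite mulr1 powR1 mul1r invrK => h.
have := ler_wpM2l (ltW a0) h; rewrite mulrDr mulrBr mulrCA mulfV ?gt_eqF//.
by rewrite !mulr1; lra.
Qed.

End real_powers.

Section geometric_mean.
Context {R : realType} {n : nat}.
Local Notation vol := (@lebesgue_rV R n).
Variables (Om : set 'rV[R]_n) (V : R).
Hypotheses (mOm : measurable Om) (volE : vol Om = V%:E).

Lemma integral_cst_vol (c : R) :
  (\int[vol]_(x in Om) (EFin \o cst c) x = (c * V)%:E)%E.
Proof.
have := integral_cst vol mOm c%:E => /= ->.
by rewrite EFinM -volE.
Qed.

Hypothesis V0 : 0 < V.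

Let Omoo : (vol Om < +oo)%E. Proof. by rewrite volE ltry. Qed.

(** Integrate 1 + q ln v <= v^q <= 1 + q ln v + B q^2 (ln v)^2; the linear term
has integral 0. The factor B is exp b for b = ln B, which bounds q ln v when q
<= 1. *)
Lemma int_pow_near_vol (v : 'rV[R]_n -> R) (B : R) : 1 <= B ->
  measurable_fun Om v -> (forall x, Om x -> 0 < v x <= B) ->
  vol.-integrable Om (EFin \o (fun x => ln (v x))) ->
  vol.-integrable Om (EFin \o (fun x => ln (v x) ^+ 2)) ->
  (\int[vol]_(x in Om) (ln (v x))%:E = 0)%E ->
  exists2 K, 0 <= K & forall q, 0 < q -> q <= 1 ->
    exists2 i, int_pow Om q v = i%:E & V <= i <= V + q ^+ 2 * K.
Proof.
move=> B1 mv vB iw iw2 w0.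
pose W := fine (\int[vol]_(x in Om) (ln (v x) ^+ 2)%:E)%E.
have WE : (\int[vol]_(x in Om) (ln (v x) ^+ 2)%:E = W%:E)%E.
  by rewrite fineK//; exact: integrable_fin_num iw2.
have W0 : 0 <= W.
  by rewrite -lee_fin -WE; apply: integral_ge0 => x _; rewrite lee_fin sqr_ge0.
have B0 : 0 < B by exact: lt_le_trans B1.
exists (B * W); first by rewrite mulr_ge0// ltW.
move=> q q0 q1.
have powE x : Om x -> `|v x| `^ q = expR (q * ln (v x)).
  by move=> /vB/andP[vx _]; rewrite gtr0_norm// /powR gt_eqF.
have ie : vol.-integrable Om (EFin \o (fun x => `|v x| `^ q)).
  apply: (@integrable_bounded _ _ _ _ _ mOm Omoo _ (B `^ q)).
    exact: measurable_pow.
  move=> x /vB/andP[vx vxB]; rewrite ger0_norm ?powR_ge0//.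
  by rewrite gtr0_norm// ge0_ler_powR ?nnegrE ?(ltW q0) ?(ltW vx) ?(ltW B0).
have i1 : vol.-integrable Om (EFin \o cst 1).
  by apply: (@integrable_bounded _ _ _ _ _ mOm Omoo (cst 1) `|1|).
have iq : vol.-integrable Om (EFin \o (fun x => q * ln (v x))).
  exact: (integrableZl mOm q iw).
have iq2 : vol.-integrable Om (EFin \o (fun x => (q ^+ 2 * B) * ln (v x) ^+ 2)).
  exact: (integrableZl mOm (q ^+ 2 * B) iw2).
have l1 : (\int[vol]_(x in Om) ((cst 1 x)%:E + (q * ln (v x))%:E) = V%:E)%E.
  rewrite integralD_EFin// integral_cst_vol mul1r.
  under eq_integral do rewrite /= EFinM.
  by rewrite integralZl// w0 mule0 adde0.
have iD := integrableD mOm i1 iq.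
have l2 : (\int[vol]_(x in Om) (((cst 1 x)%:E + (q * ln (v x))%:E) +
    ((q ^+ 2 * B) * ln (v x) ^+ 2)%:E) = (V + q ^+ 2 * (B * W))%:E)%E.
  rewrite integralD// l1; under eq_integral do rewrite /= EFinM.
  by rewrite integralZl// WE -EFinM -EFinD mulrA.
have lnB x : Om x -> q * ln (v x) <= ln B.
  move=> /vB/andP[vx vxB]; have lB : 0 <= ln B by rewrite ln_ge0.
  have : ln (v x) <= ln B by rewrite ler_ln ?posrE.
  by move=> h; nra.
exists (fine (int_pow Om q v)).
  by rewrite fineK//; exact: (integrable_fin_num mOm ie).
rewrite -!lee_fin fineK; last exact: (integrable_fin_num mOm ie).
rewrite -{1}l1 -l2; apply/andP; split; apply: le_integral => //.
- by move=> x /set_mem Ox; rewrite -EFinD lee_fin powE// expR_ge1Dx.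
- exact: integrableD.
- move=> x /set_mem Ox; rewrite -!EFinD lee_fin powE//.
  have lB : 0 <= ln B by rewrite ln_ge0.
  have := expR_le_quadratic lB (lnB _ Ox); rewrite lnK ?posrE//.
  by rewrite exprMn /=; lra.
Qed.

(** The bounds raised to the power 1/q: the lower one stays 1, the upper one is
at most exp(q K / V) since 1 + x <= exp x. *)
Lemma geometric_mean_cvg (v : 'rV[R]_n -> R) (K : R) : 0 <= K ->
  (forall q, 0 < q -> q <= 1 ->
    exists2 i, int_pow Om q v = i%:E & V <= i <= V + q ^+ 2 * K) ->
  (((vol Om)^-1 * int_pow Om q v) `^ q^-1)%E @[q --> 0^'+] --> 1%E.
Proof.
move=> K0 near_vol.
apply: (@squeeze_cvge _ _ _ _ (cst 1%E) _ (fun q => (expR (q * (K / V)))%:E)).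
- near=> q.
  have q0 : 0 < q by near: q; exact: nbhs_right_gt.
  have q1 : q <= 1 by near: q; apply: nbhs_right_le.
  have [i -> /andP[Vi iV]] := near_vol q q0 q1.
  rewrite volE inver gt_eqF// -EFinM poweR_EFin !lee_fin.
  have h1 : 1 <= V^-1 * i by rewrite ler_pdivlMl// mulr1.
  have q10 : 0 <= q^-1 by rewrite invr_ge0 ltW.
  apply/andP; split.
    have := @ge0_ler_powR R q^-1 q10 1 (V^-1 * i).
    by rewrite !nnegrE powR1 => /(_ ler01 (le_trans ler01 h1) h1).
  have h2 : V^-1 * i <= expR (q ^+ 2 * (K / V)).
    apply: le_trans (expR_ge1Dx _); rewrite ler_pdivrMl//.
    rewrite (_ : V * _ = V + q ^+ 2 * K)//; field.
    by rewrite gt_eqF.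
  have -> : expR (q * (K / V)) = expR (q ^+ 2 * (K / V)) `^ q^-1.
    rewrite -expRM; congr expR; field.
    by rewrite !gt_eqF.
  rewrite ge0_ler_powR ?nnegrE// ?expR_ge0//.
  exact: le_trans h1.
- exact: cvg_cst.
- apply/cvg_EFin; first by near=> q.
  have -> : 1 = expR (0 * (K / V)) :> R by rewrite mul0r expR0.
  apply: cvg_at_right_filter.
  apply: (@continuous_comp _ _ _ (fun q : R => q * (K / V)) expR).
    exact: mulrr_continuous.
  exact: continuous_expR.
Unshelve. all: by end_near. Qed.

End geometric_mean.

Section rayleigh_quotient.
Context {R : realType} {n : nat}.
Local Notation vol := (@lebesgue_rV R n).
Variables (Om : set 'rV[R]_n) (p V : R).
Hypotheses (mOm : measurable Om) (volE : vol Om = V%:E) (V0 : 0 < V) (p1 : 1 <= p).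

Let Omoo : (vol Om < +oo)%E. Proof. by rewrite volE ltry. Qed.

(** The function v divided by its L^q norm i^(1/q) is admissible. *)
Lemma lambda_le v g q i : 0 < q -> 0 < i -> W01p Om p v g -> int_pow Om q v = i%:E ->
  (lambda Om p q <= (i `^ (- (p / q)))%:E * dirichlet_energy Om p g)%E.
Proof.
move=> q0 i0 Wv vi; pose c := i `^ (- q^-1).
have [[[mv _] Lg _] _] := Wv.
have mg i' : measurable_fun Om (fun x => g x ord0 i') by case: (Lg i').
have c0 : 0 <= c by exact: powR_ge0.
apply: ereal_inf_lbound; exists (fun x => c * v x), (fun x => c *: g x); split.
- exact: W01pZ.
- rewrite int_powZ// vi ger0_norm// -powRrM mulNr mulVf ?gt_eqF//.
  by rewrite powR_inv1 ?ltW// -EFinM mulVf// gt_eqF.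
- by rewrite dirichlet_energyZ// ger0_norm// -powRrM mulNr mulrC.
Qed.

Lemma lambda_vol_le v g q i : 0 < q -> W01p Om p v g -> int_pow Om q v = i%:E ->
  V <= i -> (lambda Om p q * vol Om `^ (p / q) <= dirichlet_energy Om p g)%E.
Proof.
move=> q0 Wv vi Vi; have i0 : 0 < i by exact: lt_le_trans Vi.
have E0 : (0 <= dirichlet_energy Om p g)%E by exact: int_pow_ge0.
rewrite volE poweR_EFin muleC.
apply: (@le_trans _ _ ((V `^ (p / q))%:E * ((i `^ (- (p / q)))%:E * dirichlet_energy Om p g))%E).
  apply: lee_wpmul2l; first by rewrite lee_fin powR_ge0.
  exact: (lambda_le _ _ Wv).
rewrite muleA -EFinM -[leRHS]mul1e lee_wpmul2r// lee_fin powRN.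
rewrite ler_pdivrMr ?powR_gt0// mul1r ge0_ler_powR ?nnegrE ?(ltW V0) ?(ltW i0)//.
by rewrite divr_ge0 ?(ltW q0)// (le_trans ler01).
Qed.

(** Jensen's inequality for the exponent a = s / q >= 1, through its tangent
line: Bernoulli's inequality at t = V |v|^q, a function of mean 1 on Om. *)
Lemma int_pow_jensen v q s : 0 < q -> q <= s -> s <= 1 -> Lp Om p v ->
  int_pow Om q v = 1%E ->
  exists2 i, int_pow Om s v = i%:E & V `^ (1 - s / q) <= i.
Proof.
move=> q0 qs s1 [mv voo] v1.
have s0 : 0 < s by exact: lt_le_trans qs.
have i1 : vol.-integrable Om (EFin \o cst 1).
  by apply: (@integrable_bounded _ _ _ _ _ mOm Omoo (cst 1) `|1|).
have ipow r : (int_pow Om r v < +oo)%E ->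
    vol.-integrable Om (EFin \o (fun x => `|v x| `^ r)).
  move=> roo; apply/integrableP; split.
    by apply/measurable_EFinP; exact: measurable_pow.
  by under eq_integral do rewrite /= ger0_norm ?powR_ge0//.
have is_ : vol.-integrable Om (EFin \o (fun x => `|v x| `^ s)).
  apply: le_integrable (integrableD mOm i1 (ipow _ voo)) => //.
    by apply/measurable_EFinP; exact: measurable_pow.
  move=> x _ /=; rewrite lee_fin [leLHS]ger0_norm ?powR_ge0// [leRHS]ger0_norm ?addr_ge0 ?powR_ge0//.
  have [vx|vx] := leP `|v x| 1.
    apply: (@le_trans _ _ (1 `^ s)); last by rewrite powR1 /= lerDl powR_ge0.
    by rewrite ge0_ler_powR ?nnegrE ?(ltW s0).
  apply: (@le_trans _ _ (`|v x| `^ p)); last by rewrite lerDr.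
  by apply: ler_powR; [exact: ltW|exact: le_trans p1].
have iq : vol.-integrable Om (EFin \o (fun x => `|v x| `^ q)).
  by apply: ipow; rewrite v1 ltry.
pose i := fine (int_pow Om s v).
have iE : int_pow Om s v = i%:E.
  by rewrite fineK//; exact: integrable_fin_num is_.
exists i => //.
pose a := s / q.
have a1 : 1 <= a by rewrite ler_pdivlMr// mul1r.
have a0 : 0 <= a by exact: le_trans a1.
have iqa : vol.-integrable Om (EFin \o (fun x => a * V * `|v x| `^ q)).
  exact: (integrableZl mOm (a * V) iq).
have ic : vol.-integrable Om (EFin \o cst (1 - a)).
  by apply: (@integrable_bounded _ _ _ _ _ mOm Omoo (cst (1 - a)) `|1 - a|).
have isa : vol.-integrable Om (EFin \o (fun x => V `^ a * `|v x| `^ s)).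
  exact: (integrableZl mOm (V `^ a) is_).
have : (\int[vol]_(x in Om) ((cst (1 - a) x)%:E + (a * V * `|v x| `^ q)%:E) <=
    \int[vol]_(x in Om) (V `^ a * `|v x| `^ s)%:E)%E.
  apply: le_integral => //; first exact: integrableD.
  move=> x _; rewrite -EFinD lee_fin.
  have t0 : 0 <= V * `|v x| `^ q by rewrite mulr_ge0 ?powR_ge0// ltW.
  have := bernoulli_powR t0 a1; rewrite powRM ?powR_ge0 ?(ltW V0)//.
  by rewrite -powRrM /a mulrCA mulfV ?gt_eqF// mulr1 /=; lra.
rewrite integralD_EFin// (integral_cst_vol mOm volE).
under eq_integral do rewrite /= EFinM.
under [leRHS]eq_integral do rewrite EFinM.
rewrite !integralZl// -/(int_pow _ _ _) -/(int_pow _ _ _) v1 iE mule1.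
rewrite -!EFinM -EFinD lee_fin.
rewrite (_ : _ + _ = V) => [VVi|]; last by ring.
rewrite powRB; last by rewrite (gt_eqF V0) implybT.
by rewrite powRr1 ?(ltW V0)// ler_pdivrMr ?powR_gt0// mulrC.
Qed.

(** An admissible function for q has, by Jensen's inequality, an L^s norm large
enough for its rescaling to be a good competitor for s. *)
Lemma lambda_vol_nonincreasing q s : 0 < q -> q <= s -> s <= 1 ->
  (lambda Om p s * vol Om `^ (p / s) <= lambda Om p q * vol Om `^ (p / q))%E.
Proof.
move=> q0 qs s1; have s0 : 0 < s by exact: lt_le_trans qs.
rewrite volE !poweR_EFin.
have Vq : 0 < V `^ (p / q) by rewrite powR_gt0.
rewrite -lee_pdivrMr//; apply: le_ereal_inf_tmp => _ [v [g [Wv v1 ->]]].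
have [[Lv _ _] _] := Wv.
have [i vi iV] := int_pow_jensen q0 qs s1 Lv v1.
have i0 : 0 < i by apply: lt_le_trans iV; rewrite powR_gt0.
have E0 : (0 <= dirichlet_energy Om p g)%E by exact: int_pow_ge0.
have p0 : 0 <= p by exact: le_trans p1.
rewrite lee_pdivrMr//.
apply: (@le_trans _ _ ((i `^ (- (p / s)))%:E * dirichlet_energy Om p g * (V `^ (p / s))%:E)%E).
  apply: lee_wpmul2r; first by rewrite lee_fin powR_ge0.
  exact: (lambda_le _ _ Wv).
rewrite [leLHS]muleAC -EFinM [leRHS]muleC lee_wpmul2r// lee_fin powRN.
rewrite mulrC ler_pdivrMr ?powR_gt0//.
have -> : V `^ (p / s) = V `^ (p / q) * (V `^ (1 - s / q)) `^ (p / s).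
  rewrite -powRrM -powRD; last by rewrite (gt_eqF V0) implybT.
  by congr (_ `^ _); field; rewrite !gt_eqF.
rewrite ler_pM2l// ge0_ler_powR ?nnegrE ?powR_ge0 ?(ltW i0)//.
by rewrite divr_ge0// ltW.
Qed.

End rayleigh_quotient.

(** * A positive profile with square integrable logarithm *)

Section test_profile.
Context {R : realType} {n : nat}.
Local Notation vol := (@lebesgue_rV R n).
Implicit Types (Om : set 'rV[R]_n) (u : 'rV[R]_n -> R).

Lemma exists_log_square_integrable Om p : bounded_smooth_domain Om -> 1 <= p ->
  exists (u : 'rV[R]_n -> R) (g : 'rV[R]_n -> 'rV[R]_n), [/\ W01p Om p u g,
    forall x, Om x -> 0 < u x <= 2 &
    (\int[vol]_(x in Om) (ln (u x) ^+ 2)%:E < +oo)%E].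
Proof.
move=> hOm p1; have [_ oOm _ bOm _] := hOm.
have mOm := open_measurable_rV oOm.
have Omoo := vol_bounded_lty mOm bOm.
have [M M0 OmM] := bounded_cube bOm.
pose K := (Num.truncn M).+1.
have OmK : Om `<=` cube 0 K%:R.
  by move=> x /OmM xM i; apply: le_trans (xM i) _; exact/ltW/truncnS_gt.
pose psi := whitney Om K.
have psiT k : test_function Om (psi k) by exact: whitney_test.
have psi1 k x : `|psi k x| <= 1 / 2 ^+ k by exact: whitney_le.
have dpsi1 k i x : `|partial i (psi k) x| <= 1 / 2 ^+ k by exact: partial_whitney_le.
pose u := series_fun psi.
have Wu : W01p Om p u (series_grad psi) by exact: W01p_series.
have [[[measu _] _ _] _] := Wu.
have psi_u k x : psi k x <= u x.
  have cu := geometric_series_cvg (psi1 ^~ x).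
  apply: limr_ge => //; near=> m.
  have km : (k < m)%N by near: m; exact: nbhs_infty_gt.
  rewrite /series /= big_mkord (bigD1 (Ordinal km))//= lerDl sumr_ge0// => j _.
  exact: whitney_ge0.
pose beta : R := @weight R n K 0 * expR (- 4) ^+ n.
have beta0 : 0 < beta by rewrite mulr_gt0 ?weight_gt0 ?exprn_gt0 ?expR_gt0.
have ulow k x : Om x -> cube x (3 / 2 ^+ k) `<=` Om ->
    beta / (2 ^+ k) ^+ n.+2 <= u x.
  move=> Ox xOm; apply: le_trans (psi_u k x).
  by have := whitney_lower OmK Ox xOm; rewrite weightE mulrAC.
have u2 x : Om x -> 0 < u x <= 2.
  move=> Ox; apply/andP; split; last first.
    apply: le_trans (ler_norm _) _.
    by have := geometric_sum_bound (psi1 ^~ x); rewrite mulr1.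
  have /nbhs_cube[rho rho0 xOm] : nbhs x Om by exact: open_nbhs_nbhs.
  have [k krho] := exists_scale 3 rho0.
  apply: (@lt_le_trans _ _ (beta / (2 ^+ k) ^+ n.+2)).
    by rewrite divr_gt0// !exprn_gt0.
  by apply: ulow => // y xy; apply: xOm => i; exact: le_trans (xy i) krho.
exists u, (series_grad psi); split=> //.
exact: (log_square_integral oOm Omoo measu beta0 (collar_volume hOm) u2 ulow).
Unshelve. all: by end_near. Qed.

(** c is the inverse of the geometric mean of u. *)
Lemma log_normalize Om V u : measurable Om -> vol Om = V%:E -> 0 < V ->
  measurable_fun Om u -> (forall x, Om x -> 0 < u x) ->
  (\int[vol]_(x in Om) (ln (u x) ^+ 2)%:E < +oo)%E ->
  exists2 c, 0 < c &
    [/\ vol.-integrable Om (EFin \o (fun x => ln (c * u x))),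
        vol.-integrable Om (EFin \o (fun x => ln (c * u x) ^+ 2)) &
        (\int[vol]_(x in Om) (ln (c * u x))%:E = 0)%E].
Proof.
move=> mOm volE V0 mu u0 lnoo.
have Omoo : (vol Om < +oo)%E by rewrite volE ltry.
have icst r : vol.-integrable Om (EFin \o cst r).
  by apply: (@integrable_bounded _ _ _ _ _ mOm Omoo (cst r) `|r|).
have mln : measurable_fun Om (fun x => ln (u x)).
  exact: (measurableT_comp (@measurable_ln R)).
have iln2 : vol.-integrable Om (EFin \o (fun x => ln (u x) ^+ 2)).
  apply/integrableP; split; first by apply/measurable_EFinP; exact: measurable_funX.
  by under eq_integral do rewrite /= ger0_norm ?sqr_ge0//.
have iln : vol.-integrable Om (EFin \o (fun x => ln (u x))).
  apply: le_integrable (integrableD mOm (icst 1) iln2) => //.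
    exact/measurable_EFinP.
  move=> x _ /=; rewrite lee_fin [leRHS]ger0_norm ?addr_ge0 ?sqr_ge0//.
  by rewrite -[_ ^+ 2]real_normK ?num_real//; nra.
pose a := fine (\int[vol]_(x in Om) (ln (u x))%:E)%E / V.
have aE : (\int[vol]_(x in Om) (ln (u x))%:E = (a * V)%:E)%E.
  by rewrite /a divfK ?gt_eqF// fineK//; exact: (integrable_fin_num mOm iln).
exists (expR (- a)); first exact: expR_gt0.
have lnv x : Om x -> ln (expR (- a) * u x) = ln (u x) - a.
  by move=> Ox; rewrite lnM ?posrE ?expR_gt0 ?u0// expRK addrC.
have mlnv : measurable_fun Om (fun x => ln (expR (- a) * u x)).
  by apply: (measurableT_comp (@measurable_ln R)); exact: measurable_funM.
split.
- apply: eq_integrable (integrableB mOm iln (icst a)) => // x /set_mem Ox /=.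
  by rewrite lnv.
- have two_sqr (t : R) : 0 <= 2 * t ^+ 2 by rewrite mulr_ge0// sqr_ge0.
  apply: le_integrable
    (integrableD mOm (integrableZl mOm 2 iln2) (icst (2 * a ^+ 2))) => //.
    by apply/measurable_EFinP; exact: measurable_funX.
  move=> x Ox /=; rewrite lnv// lee_fin [leLHS]ger0_norm ?sqr_ge0//.
  rewrite [leRHS]ger0_norm ?addr_ge0//.
  by have := sqr_ge0 (ln (u x) + a); rewrite sqrrD sqrrB; lra.
- rewrite (eq_integral (fun x => (ln (u x))%:E - (cst a x)%:E)%E); last first.
    by move=> x /set_mem Ox; rewrite lnv// EFinB.
  rewrite (integralB_EFin mOm iln (icst a)) aE.
  have -> : (\int[vol]_(x in Om) (cst a x)%:E = (a * V)%:E)%E.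
    exact: (integral_cst_vol mOm volE).
  by rewrite subee.
Qed.

End test_profile.

Theorem theorem8 (R : realType) (N : nat) (hN : (2 <= N)%N) (p : R)
    (hp : 1 < p) (Om : set 'rV[R]_N) (hOm : bounded_smooth_domain Om) :
  exists (v : 'rV[R]_N -> R) (g : 'rV[R]_N -> 'rV[R]_N),
    [/\ W01p Om p v g,
        forall x, Om x -> 0 < v x,
        (((lebesgue_rV N Om)^-1 * int_pow Om q v) `^ q^-1)%E
          @[q --> 0^'+] --> 1%E &
        (mu Om p <= dirichlet_energy Om p g)%E].
Proof.
have p1 : 1 <= p by exact: ltW.
have [Om0 oOm _ bOm _] := hOm.
have mOm := open_measurable_rV oOm.
pose V := fine (lebesgue_rV N Om).
have volE : lebesgue_rV N Om = V%:E.
  by rewrite fineK// ge0_fin_numE//; exact: vol_bounded_lty.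
have V0 : 0 < V by rewrite -lte_fin -volE; exact: vol_open_gt0.
have [u [h [Wu u2 lnoo]]] := exists_log_square_integrable hOm p1.
have [[[measu _] _ _] _] := Wu.
have u0 x : Om x -> 0 < u x by move=> /u2/andP[].
have [c c0 [iln iln2 ln0]] := log_normalize mOm volE V0 measu u0 lnoo.
pose v x := c * u x.
have Wv : W01p Om p v (fun x => c *: h x).
  by apply: W01pZ => //; rewrite volE ltry.
have mv : measurable_fun Om v by exact: measurable_funM.
have B1 : 1 <= Num.max (c * 2) 1 by rewrite le_max lexx orbT.
have vB x : Om x -> 0 < v x <= Num.max (c * 2) 1.
  by move=> /u2/andP[ux ux2]; rewrite mulr_gt0//= le_max ler_pM2l// ux2.
have [L L0 near_vol] := int_pow_near_vol mOm volE B1 mv vB iln iln2 ln0.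
exists v, (fun x => c *: h x); split => //.
- by move=> x /vB/andP[].
- exact: (geometric_mean_cvg volE V0 L0 near_vol).
apply: lime_le.
  apply: nonincreasing_at_right_is_cvge; near=> s => q r.
  rewrite !in_itv /= => /andP[q0 qs] /andP[r0 rs] qr.
  apply: (lambda_vol_nonincreasing mOm volE V0 p1) => //.
  apply: le_trans (ltW rs) _; near: s; exact: nbhs_right_le.
near=> q.
have q0 : 0 < q by near: q; exact: nbhs_right_gt.
have q1 : q <= 1 by near: q; exact: nbhs_right_le.
have [i vi /andP[Vi _]] := near_vol q q0 q1.
exact: (lambda_vol_le mOm volE V0 p1 q0 Wv vi Vi).
Unshelve. all: by end_near. Qed.
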